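(* Let $P\subseteq\mathbb{R}^{p+q}$ be a rational polyhedron with $P_I\neq\emptyset$, let $cx+hy$ ($c\in\mathbb{Q}^p$, $h\in\mathbb{Q}^q$) be an objective function bounded above on $P$, let $\gamma^*=\max\{cx+hy:(x,y)\in P_I\}$ and $M=\{(x,y)\in P_I: cx+hy=\gamma^*\}$. If $\mathrm{relint}(\mathrm{proj}_X(M))\cap\mathbb{Z}^p\neq\emptyset$, then there exists $k\in\mathbb{N}$ with $\sup\{cx+hy:(x,y)\in P^{(k)}\}=\gamma^*$.
   Context: $P_I=\mathrm{conv}\{(x,y)\in P:x\in\mathbb{Z}^p\}$; $\mathrm{proj}_X(S)=\{x\in\mathbb{R}^p:\exists y,\ (x,y)\in S\}$; $\mathrm{relint}$ denotes relative interior. A split disjunction is a pair of inequalities $dx\le\delta$, $-dx\le-\delta-1$ with $d\in\mathbb{Z}^p$, $\delta\in\mathbb{Z}$ (a 2-disjunction). For a closed convex set $C\subseteq\mathbb{R}^{p+q}$, an inequality $\alpha x+\beta y\le\gamma$ is a split cut (2-disjunctive cut) for $C$ if it is not valid for $C$ and there exist $d\in\mathbb{Z}^p,\delta\in\mathbb{Z}$ such that every $(x,y)\in C$ with $\alpha x+\beta y>\gamma$ satisfies $\delta<dx<\delta+1$. The split closure of $C$ is the intersection of $C$ with all half-spaces given by split cuts for $C$; $P^{(0)}=P$ and $P^{(k)}$ is the split closure of $P^{(k-1)}$. *)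

(* Defs.v *)
From Stdlib Require Import Reals ZArith List.
From mathcomp Require Import ssreflect ssrfun ssrbool eqtype ssrnat seq fintype.
Open Scope R_scope.

Definition vec (n : nat) := 'I_n -> R.

Definition dot {n : nat} (a b : vec n) : R :=
  foldr (fun i acc => a i * b i + acc) 0 (enum 'I_n).

Definition dist {n : nat} (a b : vec n) : R :=
  sqrt (dot (fun i => a i - b i) (fun i => a i - b i)).

Definition is_int (r : R) : Prop := exists z : Z, r = IZR z.
Definition is_rat (r : R) : Prop :=
  exists a b : Z, b <> 0%Z /\ r = IZR a / IZR b.

Definition pt (p q : nat) := (vec p * vec q)%type.

Definition rational_polyhedron {p q : nat} (P : pt p q -> Prop) : Prop :=
  exists (m : nat) (A : 'I_m -> vec p) (G : 'I_m -> vec q) (b : 'I_m -> R),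
    (forall i j, is_rat (A i j)) /\ (forall i j, is_rat (G i j)) /\
    (forall i, is_rat (b i)) /\
    (forall z : pt p q, P z <-> forall i, dot (A i) z.1 + dot (G i) z.2 <= b i).

Definition wsum {n : nat} (l : list (R * vec n)) : vec n :=
  fun i => foldr (fun wz acc => wz.1 * wz.2 i + acc) 0 l.
Definition wtotal {A : Type} (l : list (R * A)) : R :=
  foldr (fun wz acc => wz.1 + acc) 0 l.

Definition conv {p q : nat} (S : pt p q -> Prop) (z : pt p q) : Prop :=
  exists l : list (R * pt p q),
    Forall (fun wz => 0 <= wz.1 /\ S wz.2) l /\ wtotal l = 1 /\
    (forall i, z.1 i = wsum (map (fun wz => (wz.1, wz.2.1)) l) i) /\
    (forall j, z.2 j = wsum (map (fun wz => (wz.1, wz.2.2)) l) j).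

Definition P_I {p q : nat} (P : pt p q -> Prop) : pt p q -> Prop :=
  conv (fun z => P z /\ forall i, is_int (z.1 i)).

Definition projX {p q : nat} (S : pt p q -> Prop) (x : vec p) : Prop :=
  exists y, S (x, y).

Definition aff {n : nat} (S : vec n -> Prop) (x : vec n) : Prop :=
  exists l : list (R * vec n),
    Forall (fun wz => S wz.2) l /\ wtotal l = 1 /\
    (forall i, x i = wsum l i).

Definition relint {n : nat} (S : vec n -> Prop) (x : vec n) : Prop :=
  S x /\ exists eps, 0 < eps /\
    forall z, aff S z -> dist z x < eps -> S z.

Definition split_cut {p q : nat} (C : pt p q -> Prop)
    (alpha : vec p) (beta : vec q) (g0 : R) : Prop :=
  (~ forall z, C z -> dot alpha z.1 + dot beta z.2 <= g0) /\
  exists (d : 'I_p -> Z) (delta : Z),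
    forall z, C z -> dot alpha z.1 + dot beta z.2 > g0 ->
      IZR delta < dot (fun i => IZR (d i)) z.1 < IZR delta + 1.

Definition split_closure {p q : nat} (C : pt p q -> Prop) (z : pt p q) : Prop :=
  C z /\ forall alpha beta g0, split_cut C alpha beta g0 ->
    dot alpha z.1 + dot beta z.2 <= g0.

Definition split_rank_closure {p q : nat} (k : nat) (P : pt p q -> Prop) :
  pt p q -> Prop := Nat.iter k split_closure P.

(* Main.v *)
(** Let x0 be the integral point of relint (proj_X M).  The value function
    x |-> max_y (c x + h y) equals gstar at x0 and is polyhedral, so P satisfies
    f <= gstar + (b - a x) / sig for some integral a with a x0 = b; since x0 is relatively
    interior, all optimal integral points lie on the hyperplane a x = b.  Hence
    integral points with a x <= b - 1 miss gstar by a fixed amount, and the tilted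
    objective N f - a x is, for N large, still maximized over P_I at x0.  Iterated split
    closures bring its maximum over P^(k) arbitrarily close to that over P_I, whence
    f <= gstar on the part a x <= b - 1 of P^(k); the part a x >= b satisfies this
    already, so the split (b - 1, b) along a finishes.

    The convergence is quantitative.  Modulo the rational directions along which the
    objective is constant, finitely many integral functionals d_i detect integrality
    and are bounded on the relevant part of P, so no compactness of P is needed. *)
Require Import Defs.
From Stdlib Require Import Reals ZArith List.
From mathcomp Require Import all_boot all_order all_algebra.
From mathcomp Require Import boolp Rstruct.
From mathcomp Require Import lra ring zify.
Set Implicit Arguments.
Unset Strict Implicit.
Unset Printing Implicit Defensive.
Import Order.TTheory GRing.Theory Num.Theory.
Local Open Scope ring_scope.

(** * Integral cones *)

Definition ipair {R : pzRingType} {I : finType} (a : I -> int) (x : I -> R) : R :=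
  \sum_i (a i)%:~R * x i.

Definition in_cone {R : numDomainType} {I : finType} {s : nat}
    (G : 'I_s -> I -> int) (w : I -> R) : Prop :=
  exists c : 'I_s -> R,
    (forall j, 0 <= c j) /\ forall i, w i = \sum_j c j * (G j i)%:~R.

Lemma ipair_intr (R : pzRingType) (I : finType) (a b : I -> int) :
  ipair a (fun i => (b i)%:~R : R) = (ipair a b)%:~R.
Proof.
rewrite /ipair rmorph_sum; apply: eq_bigr => i _.
by rewrite rmorphM /= intz.
Qed.

Lemma ipairB (R : comPzRingType) (I : finType) (a : I -> int) (x y : I -> R) :
  ipair a (fun i => x i - y i) = ipair a x - ipair a y.
Proof. by rewrite /ipair -sumrB; apply: eq_bigr => i _; rewrite mulrBr. Qed.

Lemma ipairD (R : comPzRingType) (I : finType) (a : I -> int) (x y : I -> R) :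
  ipair a (fun i => x i + y i) = ipair a x + ipair a y.
Proof. by rewrite /ipair -big_split; apply: eq_bigr => i _; rewrite mulrDr. Qed.

Lemma ipairZ (R : comPzRingType) (I : finType) (a : I -> int) (t : R) (x : I -> R) :
  ipair a (fun i => t * x i) = t * ipair a x.
Proof. by rewrite /ipair mulr_sumr; apply: eq_bigr => i _; rewrite mulrCA. Qed.

Lemma ipair_sum (R : comPzRingType) (I J : finType) (a : I -> int) (F : J -> I -> R) :
  ipair a (fun i => \sum_j F j i) = \sum_j ipair a (F j).
Proof.
rewrite /ipair exchange_big /=; apply: eq_bigr => i _.
by rewrite mulr_sumr.
Qed.

Lemma eq_ipair (R : pzRingType) (I : finType) (a : I -> int) (x y : I -> R) :
  x =1 y -> ipair a x = ipair a y.
Proof. by move=> e; apply: eq_bigr => i _; rewrite e. Qed.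

Lemma ipair_comb (R : comPzRingType) (I J : finType) (a : I -> int) (c : J -> R)
    (G : J -> I -> int) :
  ipair a (fun i => \sum_j c j * (G j i)%:~R) = \sum_j c j * (ipair a (G j))%:~R.
Proof.
rewrite ipair_sum; apply: eq_bigr => j _.
by rewrite ipairZ ipair_intr.
Qed.

(** The one-variable step of Fourier-Motzkin elimination; the witness is the maximum of 0 and all
    lower bounds. *)
Lemma between_exists (R : realDomainType) (L U : seq R) :
  (forall u, u \in U -> 0 <= u) ->
  (forall l u, l \in L -> u \in U -> l <= u) ->
  exists t, [/\ 0 <= t, forall l, l \in L -> l <= t & forall u, u \in U -> t <= u].
Proof.
move=> U0; elim: L => [|l L IH] LU.
  by exists 0; split => // u /U0.
case: IH => [l' u l'L uU|t [t0 Lt tU]]; first by apply: LU => //; rewrite inE l'L orbT.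
exists (Num.max t l); split.
- by rewrite le_max t0.
- by move=> l'; rewrite inE le_max => /orP[/eqP->|/Lt->//]; rewrite lexx orbT.
- by move=> u uU; rewrite ge_max tU // LU // mem_head.
Qed.

(** Splits off the coefficient [t] of the first generator, the variable that [weyl] eliminates. *)
Lemma in_coneS (R : numDomainType) (I : finType) (s : nat)
    (G : 'I_s.+1 -> I -> int) (w : I -> R) :
  in_cone G w <-> exists t, 0 <= t /\
    in_cone (fun j => G (lift ord0 j)) (fun i => w i - t * (G ord0 i)%:~R).
Proof.
split=> [[c [c0 wE]]|[t [t0 [c [c0 wE]]]]].
  exists (c ord0); split => //; exists (fun j => c (lift ord0 j)); split => // i.
  by rewrite wE big_ord_recl addrAC subrr add0r.
exists (fun j => if unlift ord0 j is Some k then c k else t); split.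
  by move=> j; case: unliftP.
move=> i; rewrite big_ord_recl unlift_none.
under eq_bigr => j _ do rewrite liftK.
by rewrite -wE addrC subrK.
Qed.

(* Fourier-Motzkin elimination of the coefficient of one generator at a time. *)
Lemma weyl (R : realFieldType) (I : finType) (s : nat) (G : 'I_s -> I -> int) :
  exists M : seq {ffun I -> int}, forall w : I -> R,
    in_cone G w <-> forall m, m \in M -> ipair m w <= 0.
Proof.
elim: s G => [|s IH] G.
  (* Without generators the cone is the origin, cut out by both signs of every coordinate. *)
  exists ([seq [ffun k => (k == i)%:Z] | i <- enum I] ++
          [seq [ffun k => - (k == i)%:Z] | i <- enum I]) => w.
  have pairE i : ipair [ffun k => (k == i)%:Z] w = w i.
    rewrite /ipair (bigD1 i) //= ffunE eqxx mul1r big1 ?addr0 // => k /negPf ki.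
    by rewrite ffunE ki mul0r.
  have pairN i : ipair [ffun k => - (k == i)%:Z] w = - w i.
    rewrite -pairE /ipair -sumrN; apply: eq_bigr => k _.
    by rewrite !ffunE mulrNz mulNr.
  split=> [[c [_ wE]] m _|H].
    by rewrite /ipair big1 // => i _; rewrite wE big_ord0 mulr0.
  exists (fun=> 0); split => // i; rewrite big_ord0.
  apply/eqP; rewrite eq_le; apply/andP; split.
    by rewrite -pairE; apply: H; rewrite mem_cat map_f ?mem_enum.
  rewrite -oppr_le0 -pairN; apply: H; rewrite mem_cat; apply/orP; right.
  by apply/mapP; exists i; rewrite ?mem_enum.
have [M HM] := IH (fun j => G (lift ord0 j)).
pose g := G ord0; pose e (m : {ffun I -> int}) : int := ipair m g.
(* The constraints on [t] read [ipair m w <= t * e m]. A positive combination of a lower and an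
   upper bound cancels [t]; rows with [e m <= 0] are kept because [t >= 0]. *)
pose comb (m1 m2 : {ffun I -> int}) : {ffun I -> int} :=
  [ffun i => e m1 * m2 i - e m2 * m1 i].
exists ([seq m <- M | e m <= 0] ++
        [seq comb m1 m2 | m1 <- [seq m <- M | 0 < e m], m2 <- [seq m <- M | e m < 0]]) => w.
have combE m1 m2 : ipair (comb m1 m2) w =
    (e m1)%:~R * ipair m2 w - (e m2)%:~R * ipair m1 w.
  rewrite /ipair !mulr_sumr -sumrB; apply: eq_bigr => i _.
  by rewrite ffunE intrB !intrM mulrBl !mulrA.
have stepE t : in_cone (fun j => G (lift ord0 j)) (fun i => w i - t * (g i)%:~R) <->
    forall m, m \in M -> ipair m w <= t * (e m)%:~R.
  have E (m : {ffun I -> int}) : ipair m (fun i => w i - t * (g i)%:~R) = ipair m w - t * (e m)%:~R.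
    by rewrite ipairB ipairZ ipair_intr.
  rewrite HM; split => H m mM; have := H m mM; rewrite E subr_le0 //.
rewrite in_coneS; split.
  move=> [t [t0 /stepE H]] m; rewrite mem_cat => /orP[|/allpairsP[[m1 m2] /= []]].
    rewrite mem_filter => /andP[em mM]; apply: le_trans (H _ mM) _.
    by rewrite mulr_ge0_le0 // lerz0.
  rewrite !mem_filter => /andP[e1 m1M] /andP[e2 m2M] ->.
  have p1 : 0 < (e m1)%:~R :> R by rewrite ltr0z.
  have p2 : (e m2)%:~R < 0 :> R by rewrite ltrz0.
  rewrite combE; have h1 := H _ m1M; have h2 := H _ m2M; nra.
move=> H.
have [||t [t0 tL tU]] := @between_exists R
   [seq ipair m w / (e m)%:~R | m : {ffun I -> int} <- M & 0 < e m]
   [seq ipair m w / (e m)%:~R | m : {ffun I -> int} <- M & e m < 0].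
- move=> u /mapP[m]; rewrite mem_filter => /andP[em mM] ->.
  have : ipair m w <= 0 by apply: H; rewrite mem_cat mem_filter (ltW em) mM.
  by move=> h; rewrite mulr_le0 // invr_le0 lerz0 ltW.
- move=> l u /mapP[m1]; rewrite mem_filter => /andP[e1 m1M] ->.
  move=> /mapP[m2]; rewrite mem_filter => /andP[e2 m2M] ->.
  have p1 : 0 < (e m1)%:~R :> R by rewrite ltr0z.
  have p2 : (e m2)%:~R < 0 :> R by rewrite ltrz0.
  have : ipair (comb m1 m2) w <= 0.
    apply: H; rewrite mem_cat; apply/orP; right; apply/allpairsP.
    by exists (m1, m2); rewrite !mem_filter e1 e2 m1M m2M.
  by rewrite combE ler_pdivrMr // mulrAC ler_ndivlMr // subr_le0 mulrC [X in _ <= X -> _]mulrC.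
exists t; split => //; apply/stepE => m mM.
have [e0|e0|e0] := ltrgtP (e m) 0.
- have p2 : (e m)%:~R < 0 :> R by rewrite ltrz0.
  rewrite -ler_ndivlMr //; apply: tU; apply/mapP; exists m => //.
  by rewrite mem_filter e0.
- have p1 : 0 < (e m)%:~R :> R by rewrite ltr0z.
  rewrite -ler_pdivrMr //; apply: tL; apply/mapP; exists m => //.
  by rewrite mem_filter e0.
- rewrite e0 mulr0; apply: H; rewrite mem_cat mem_filter mM e0 lexx //.
Qed.

(** Polarity: [weyl] on the rows [M] yields [N], and [weyl] on [N] yields [K]. Each row of [K] is
    nonpositive on [N], hence lies in the cone of [M], so [M w <= 0] implies [K w <= 0], that is,
    [w] lies in the cone generated by [N]. *)
Lemma minkowski (R : realFieldType) (I : finType) (M : seq {ffun I -> int}) :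
  exists (s : nat) (G : 'I_s -> I -> int), forall w : I -> R,
    in_cone G w <-> forall m, m \in M -> ipair m w <= 0.
Proof.
have [N HN] := weyl R (fun j : 'I_(size M) => (tnth (in_tuple M) j : I -> int)).
have [K HK] := weyl R (fun j : 'I_(size N) => (tnth (in_tuple N) j : I -> int)).
have gen s (T : s.-tuple {ffun I -> int}) m : m \in tval T ->
    in_cone (fun j => (tnth T j : I -> int)) (fun i => (m i)%:~R : R).
  move=> /tnthP[j ->]; exists (fun k => (k == j)%:R); split => [k|i].
    by rewrite ler0n.
  by rewrite (bigD1 j) //= eqxx mul1r big1 ?addr0 // => k /negPf->; rewrite mul0r.
have NM n m : n \in N -> m \in M -> ipair n m <= 0.
  move=> nN mM; have /HN/(_ n nN) := gen _ (in_tuple M) m mM.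
  by rewrite ipair_intr lerz0.
have sym (a b : I -> int) : ipair a b = ipair b a.
  by apply: eq_bigr => i _; rewrite !intz mulrC.
exists (size N), (fun j => (tnth (in_tuple N) j : I -> int)) => w; split.
  move=> [c [c0 wE]] m mM; rewrite (eq_ipair _ wE) ipair_comb.
  apply: sumr_le0 => j _; rewrite mulr_ge0_le0 // lerz0 sym.
  by apply: NM => //; apply: mem_tnth.
move=> Hw; apply/HK => k kK.
have /HN[c [c0 kE]] : forall n, n \in N -> ipair n (fun i => (k i)%:~R : R) <= 0.
  move=> n nN; have /HK/(_ k kK) := gen _ (in_tuple N) n nN.
  by rewrite !ipair_intr sym.
rewrite /ipair; under eq_bigr => i _ do rewrite kE mulr_suml.
rewrite exchange_big /=; apply: sumr_le0 => j _.
under eq_bigr => i _ do rewrite -mulrA.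
by rewrite -mulr_sumr mulr_ge0_le0 // Hw // mem_tnth.
Qed.

(** * Generators of rational polyhedra and their projections *)

Definition lin {R : pzRingType} {p q : nat} (gx : 'I_p -> int) (gy : 'I_q -> int)
    (z : ('I_p -> R) * ('I_q -> R)) : R :=
  ipair gx z.1 + ipair gy z.2.

(* Generators with T j = 0 are rays, those with T j > 0 are T j times a point of the polyhedron. *)
Definition gen_poly {R : numDomainType} {s p q : nat} (X : 'I_s -> 'I_p -> int)
    (Y : 'I_s -> 'I_q -> int) (T : 'I_s -> int)
    (z : ('I_p -> R) * ('I_q -> R)) : Prop :=
  exists c : 'I_s -> R,
    [/\ forall j, 0 <= c j, forall i, z.1 i = \sum_j c j * (X j i)%:~R,
        forall i, z.2 i = \sum_j c j * (Y j i)%:~R & \sum_j c j * (T j)%:~R = 1].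

Lemma lin_gen (R : comPzRingType) (s p q : nat) (X : 'I_s -> 'I_p -> int)
    (Y : 'I_s -> 'I_q -> int) (c : 'I_s -> R) (gx : 'I_p -> int) (gy : 'I_q -> int)
    (z : ('I_p -> R) * ('I_q -> R)) :
  (forall i, z.1 i = \sum_j c j * (X j i)%:~R) ->
  (forall i, z.2 i = \sum_j c j * (Y j i)%:~R) ->
  lin gx gy z = \sum_j c j * (ipair gx (X j) + ipair gy (Y j))%:~R.
Proof.
move=> z1E z2E; rewrite /lin (eq_ipair _ z1E) (eq_ipair _ z2E) !ipair_comb -big_split.
by apply: eq_bigr => j _; rewrite rmorphD mulrDr.
Qed.

(** Homogenization: the polyhedron is the slice at height 1 of a cone with one more coordinate, to
    which [minkowski] applies. The row [rowt] keeps that coordinate nonnegative, whence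
    [0 <= T j]. *)
Lemma polyhedron_generators (R : realFieldType) (m p q : nat) (A : 'I_m -> 'I_p -> int)
    (G : 'I_m -> 'I_q -> int) (b : 'I_m -> int) :
  exists (s : nat) (X : 'I_s -> 'I_p -> int) (Y : 'I_s -> 'I_q -> int) (T : 'I_s -> int),
    (forall j, 0 <= T j) /\
    forall z : ('I_p -> R) * ('I_q -> R),
      (forall i, lin (A i) (G i) z <= (b i)%:~R) <-> gen_poly X Y T z.
Proof.
pose I := (('I_p + 'I_q) + 'I_1)%type.
pose rowc i : {ffun I -> int} := [ffun u : I => match u with
  | inl (inl k) => A i k | inl (inr k) => G i k | inr _ => - b i end].
pose rowt : {ffun I -> int} := [ffun u : I => (if u is inr _ then -1 else 0) : int].
have [s [H HH]] := minkowski R (rowt :: [seq rowc i | i <- enum 'I_m]).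
have pt (w : I -> R) : ipair rowt w = - w (inr ord0).
  rewrite /ipair big_sumType big_ord1 big1 => [|u _]; last by rewrite ffunE mul0r.
  by rewrite /= add0r ffunE mulN1r.
have pc i (w : I -> R) : ipair (rowc i) w =
    ipair (A i) (fun k => w (inl (inl k))) + ipair (G i) (fun k => w (inl (inr k)))
    - (b i)%:~R * w (inr ord0).
  rewrite /ipair !big_sumType big_ord1 ffunE mulrNz mulNr.
  by congr (_ + _ - _); apply: eq_bigr => k _; rewrite ffunE.
exists s, (fun j k => H j (inl (inl k))), (fun j k => H j (inl (inr k))),
  (fun j => H j (inr ord0)); split.
  move=> j; have /HH/(_ rowt) : in_cone H (fun u => (H j u)%:~R : R).
    exists (fun k => (k == j)%:R); split => [k|u]; first by rewrite ler0n.
    by rewrite (bigD1 j) //= eqxx mul1r big1 ?addr0 // => k /negPf->; rewrite mul0r.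
  by rewrite mem_head pt oppr_le0 ler0z => ->.
move=> z; pose w (u : I) : R := match u with
  | inl (inl k) => z.1 k | inl (inr k) => z.2 k | inr _ => 1 end.
transitivity (in_cone H w).
  rewrite HH; split.
    move=> Hz r; rewrite inE => /orP[/eqP->|/mapP[i _ ->]].
      by rewrite pt oppr_le0.
    by rewrite pc mulr1 subr_le0; apply: Hz.
  move=> Hw i; rewrite -subr_le0 -[X in _ - X]mulr1.
  by rewrite -(pc i w) Hw // inE map_f ?orbT ?mem_enum.
split=> [[c [c0 wE]]|[c [c0 z1 z2 cT]]].
  exists c; split => //.
  - by move=> i; rewrite -(wE (inl (inl i))).
  - by move=> i; rewrite -(wE (inl (inr i))).
  - by rewrite -(wE (inr ord0)).
exists c; split => // -[[i|i]|i] //=.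
by rewrite ord1 cT.
Qed.

(** The hypograph of [delta |-> max lin] over the fibre [d x = delta] is a slice of the cone
    generated by the images of the generators and one downward direction. [weyl] describes it by
    integral rows; the downward direction forces the coefficient of [phi], at [inr false], to be
    nonnegative. The homogenizing coordinate is [inr true]. *)
Lemma hypograph (R : realFieldType) (s p q m : nat) (X : 'I_s -> 'I_p -> int)
    (Y : 'I_s -> 'I_q -> int) (T : 'I_s -> int) (d : 'I_m -> 'I_p -> int)
    (gx : 'I_p -> int) (gy : 'I_q -> int) :
  exists rows : seq {ffun 'I_m + bool -> int},
    (forall r, r \in rows -> 0 <= r (inr false)) /\
    forall (delta : 'I_m -> R) (phi : R),
      (exists z, [/\ gen_poly X Y T z, forall i, ipair (d i) z.1 = delta i
                  & phi <= lin gx gy z]) <->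
      (forall r, r \in rows -> ipair (fun i => r (inl i)) delta + (r (inr true))%:~R
                    + (r (inr false))%:~R * phi <= 0).
Proof.
pose I := ('I_m + bool)%type.
pose G (j : 'I_s.+1) (u : I) : int := if unlift ord0 j is Some k then
    match u with inl i => ipair (d i) (X k) | inr true => T k
               | inr false => ipair gx (X k) + ipair gy (Y k) end
  else match u with inr false => -1 | _ => 0 end.
have [M HM] := weyl R G.
have pE (r : {ffun I -> int}) (w : I -> R) : ipair r w =
    ipair (fun i => r (inl i)) (fun i => w (inl i)) + (r (inr true))%:~R * w (inr true)
    + (r (inr false))%:~R * w (inr false).
  by rewrite /ipair big_sumType big_bool /= addrA.
have G0 u : G ord0 u = match u with inr false => -1 | _ => 0 end.
  by rewrite /G unlift_none.
have Gl k u : G (lift ord0 k) u =  match u with inl i => ipair (d i) (X k) | inr true => T k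
               | inr false => ipair gx (X k) + ipair gy (Y k) end.
  by rewrite /G liftK.
exists M; split.
  move=> r rM; have /HM/(_ _ rM) : in_cone G (fun u => (G ord0 u)%:~R : R).
    apply/in_coneS; exists 1; split => //; exists (fun=> 0); split => // i.
    by rewrite mul1r subrr big1 // => j _; rewrite mul0r.
  rewrite pE /ipair big1 => [|i _]; last by rewrite G0 mulr0.
  by rewrite !G0 mulr0 !add0r mulrN1 oppr_le0 ler0z.
move=> delta phi.
pose w (u : I) : R := match u with inl i => delta i | inr true => 1 | inr false => phi end.
transitivity (in_cone G w); last first.
  by rewrite HM; split => H r rM; have := H r rM; rewrite pE /= mulr1.
rewrite in_coneS; split.
  move=> [z [[c [c0 z1 z2 cT]] zd zphi]].
  (* The slack below the objective value is the coefficient of the downward direction. *)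
  exists (lin gx gy z - phi); split; first by rewrite subr_ge0.
  exists c; split => // -[i|[|]] /=.
  - rewrite G0 mulr0 subr0 -zd (eq_ipair _ z1) ipair_comb.
    by apply: eq_bigr => k _; rewrite Gl.
  - rewrite G0 mulr0 subr0 -[LHS]cT.
    by apply: eq_bigr => k _; rewrite Gl.
  - rewrite G0 mulrN1 opprK addrCA subrr addr0 (lin_gen gx gy z1 z2).
    by apply: eq_bigr => k _; rewrite Gl.
move=> [t [t0 [c [c0 H]]]].
pose z : ('I_p -> R) * ('I_q -> R) := (fun i => \sum_j c j * (X j i)%:~R,
   fun i => \sum_j c j * (Y j i)%:~R).
exists z; split.
- exists c; split => //.
  have := H (inr true); rewrite /= G0 mulr0 subr0 => E; rewrite [RHS]E.
  by apply: eq_bigr => k _; rewrite Gl.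
- move=> i; rewrite /z /= ipair_comb.
  have := H (inl i); rewrite /= G0 mulr0 subr0 => ->.
  by apply: eq_bigr => k _; rewrite Gl.
- have := H (inr false); rewrite /= G0 mulrN1 opprK => E.
  rewrite (@lin_gen _ _ _ _ X Y c) //.
  rewrite (_ : \sum_j _ = phi + t) ?lerDl // E.
  by apply: eq_bigr => k _; rewrite Gl.
Qed.

(** * Uniform constants, discreteness, and integrality modulo a subspace *)

(** The minimum of finitely many thresholds works because each [Q r] persists when its threshold
    shrinks. *)
Lemma common_pos (R : realDomainType) (U : eqType) (M : seq U) (Q : U -> R -> Prop) :
  (forall r, r \in M -> exists2 e, 0 < e & forall e', 0 < e' -> e' <= e -> Q r e') ->
  exists2 e, 0 < e & forall r, r \in M -> Q r e.
Proof.
move=> H; suff [e e0 He] : exists2 e, 0 < e & forall e', 0 < e' -> e' <= e ->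
    forall r, r \in M -> Q r e' by exists e => // r; apply: He.
elim: M H => [|r M IH] H; first by exists 1.
have [|e e0 He] := IH; first by move=> r' r'M; apply: H; rewrite inE r'M orbT.
have [|e1 e10 He1] := H r; first by rewrite mem_head.
exists (Num.min e e1); first by rewrite lt_min e0.
move=> e' e'0; rewrite le_min => /andP[l1 l2] r'; rewrite inE => /orP[/eqP->|r'M].
  exact: He1.
exact: He.
Qed.

(** The positive elements of a translate of the integers have a least one. *)
Lemma int_gap (R : archiRealFieldType) (r : R) :
  exists2 k, 0 < k & forall n : int, 0 < n%:~R + r -> k <= n%:~R + r.
Proof.
exists ((Num.floor (- r) + 1)%:~R + r); first by have := floorD1_gt (- r); lra.
move=> n n0; rewrite lerD2r ler_int lezD1 floor_lt_int; lra.
Qed.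

(* By the Smith normal form; if all [ipair (d i) x] are integers, then x is an
   integral vector modulo the real span of N. *)
Lemma lattice_quotient (R : numFieldType) (s p : nat) (N : 'I_s -> 'I_p -> int) :
  exists d u : 'I_p -> 'I_p -> int,
    (forall i j, ipair (d i) (N j) = 0) /\
    forall x : 'I_p -> R, exists c : 'I_s -> R, forall k,
      x k = \sum_i ipair (d i) x * (u i k)%:~R + \sum_j c j * (N j k)%:~R.
Proof.
pose NM := \matrix_(j, k) N j k.
have [L Lu [U Uu [e _ NE]]] := int_Smith_normal_form NM.
pose used (i : 'I_p) := (i < s)%N && (e`_i != 0).
pose D : 'M[int]_(s, p) := \matrix_(i, j) (e`_i *+ (i == j :> nat)).
have NE1 : NM *m invmx U = L *m D by rewrite NE mulmxK.
have NE2 : invmx L *m NM = D *m U by rewrite NE -mulmxA mulKmx.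
(* The rows of [U] form a lattice basis, and column [i] of its inverse reads off coordinate [i].
   Rows with nonzero invariant factor lie in the real span of [N], so only the other coordinates are
   kept. *)
pose d i k : int := if used i then 0 else invmx U k i.
exists d, (fun i k => U i k); split.
  move=> i j; rewrite /ipair /d; case nu: (used i).
    by rewrite big1 // => k _; rewrite mul0r.
  move/matrixP/(_ j i): NE1; rewrite !mxE => E.
  transitivity (\sum_k NM j k * invmx U k i).
    by apply: eq_bigr => k _; rewrite mxE intz mulrC.
  rewrite E; apply: big1 => k _; rewrite mxE.
  case: eqP => [ki|_]; last by rewrite mulr0n mulr0.
  move: nu; rewrite /used -ki ltn_ord /= => /negbFE/eqP->.
  by rewrite mul0rn mulr0.
move=> x.
pose y (i : 'I_p) : R := \sum_k x k * (invmx U k i)%:~R.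
(* Row [i] of the inverse of [L] expresses [e_i] times row [i] of [U] through [N]; the value 0 is a
   filler for indices beyond [s]. *)
pose v (i : 'I_p) (j : 'I_s) : int := if insub (val i) is Some i' then invmx L i' j else 0.
have vE i k : used i -> \sum_j (v i j)%:~R * (N j k)%:~R = (e`_i)%:~R * (U i k)%:~R :> R.
  move=> /andP[is_ _]; rewrite /v insubT /=.
  move/matrixP/(_ (Ordinal is_) k): NE2; rewrite !mxE.
  rewrite (bigD1 i) //= [X in _ = _ + X -> _]big1 ?addr0 => [|k' k'i]; last first.
    rewrite mxE /=; have [ik|_] := eqVneq (i : nat) k'; last by rewrite mulr0n mul0r.
    by case/eqP: k'i; apply: val_inj.
  rewrite mxE eqxx mulr1n -intrM => <-; rewrite rmorph_sum.
  by apply: eq_bigr => j _; rewrite mxE /= intrM.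
exists (fun j => \sum_(i | used i) y i / (e`_i)%:~R * (v i j)%:~R) => k.
have -> : x k = \sum_i y i * (U i k)%:~R.
  have rowE k' : \sum_i x k' * (invmx U k' i)%:~R * (U i k)%:~R = x k' * (k' == k)%:R.
    under eq_bigr do rewrite -mulrA -intrM.
    rewrite -mulr_sumr -rmorph_sum.
    move/matrixP/(_ k' k): (mulVmx Uu); rewrite !mxE => -> /=.
    by case: (k' == k).
  under eq_bigr do rewrite mulr_suml.
  rewrite exchange_big /=; under eq_bigr do rewrite rowE.
  rewrite (bigD1 k) //= eqxx mulr1 [X in _ + X]big1 ?addr0 // => k' /negPf->.
  by rewrite mulr0.
rewrite (bigID used) addrC; congr (_ + _); last first.
  rewrite [RHS](bigID used) [X in _ = X + _]big1 ?add0r => [|i /= ui].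
    apply: eq_bigr => i /= nu; congr (_ * _); rewrite /ipair /y.
    by apply: eq_bigr => k' _; rewrite mulrC /d (negPf nu).
  rewrite /ipair big1 ?mul0r // => k' _.
  by rewrite /d ui mul0r.
under [RHS]eq_bigr do rewrite mulr_suml.
rewrite exchange_big /=; apply: eq_bigr => i /= ui.
under eq_bigr do rewrite -mulrA.
rewrite -mulr_sumr vE // mulrA divfK // intr_eq0.
by case/andP: ui.
Qed.

(** * Convergence of split closures *)

Definition rlin {R : pzRingType} {p q : nat} (a : 'I_p -> R) (b : 'I_q -> R)
    (z : ('I_p -> R) * ('I_q -> R)) : R :=
  \sum_i a i * z.1 i + \sum_j b j * z.2 j.

(* The abstract inequality need not be violated on [C k]: a valid one stays valid. *)
Definition split_closed {R : numDomainType} {p q : nat}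
    (C : nat -> ('I_p -> R) * ('I_q -> R) -> Prop) : Prop :=
  (forall k z, C k.+1 z -> C k z) /\
  forall k a b g0 (e : 'I_p -> int) (n : int),
    (forall z, C k z -> g0 < rlin a b z -> n%:~R < ipair e z.1 < n%:~R + 1) ->
    forall z, C k.+1 z -> rlin a b z <= g0.

Lemma nat_collision (T : finType) (f : nat -> T) :
  exists j k : nat, (j < k)%N /\ f j = f k.
Proof.
have [n Tn] : exists n, #|T| = n by exists #|T|.
apply: contrapT => H.
have inj : injective (fun k : 'I_n.+1 => f k).
  move=> j k ejk; apply: ord_inj; case: (ltngtP j k) => // jk; case: H.
    by exists j, k.
  by exists k, j.
by have := leq_card _ inj; rewrite Tn card_ord ltnn.
Qed.

(** Cells of side [nu] cover the box of radius [b] with finitely many codes, so two terms share a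
    cell. *)
Lemma pigeonhole_close (R : archiRealFieldType) (I : finType) (u : nat -> I -> R) (b nu : R) :
  (forall k i, `|u k i| <= b) -> 0 < nu ->
  exists j k, (j < k)%N /\ forall i, `|u j i - u k i| <= nu.
Proof.
move=> ub nu0; pose t k i := Num.truncn ((u k i + b) / nu).
pose N := Num.truncn (b *+ 2 / nu).
have u0 k i : 0 <= (u k i + b) / nu.
  by apply: divr_ge0; last exact: ltW; have := ub k i; rewrite ler_norml => /andP[]; lra.
have tN k i : (t k i < N.+1)%N.
  rewrite ltnS; apply: le_truncn; rewrite ler_pM2r ?invr_gt0 //.
  by have := ub k i; rewrite ler_norml => /andP[]; lra.
pose code k : {ffun I -> 'I_N.+1} := [ffun i => inord (t k i)].
have [j [k [jk ejk]]] := nat_collision code.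
exists j, k; split => // i.
have tjk : t j i = t k i.
  by move/ffunP/(_ i): ejk; rewrite !ffunE => /(congr1 val); rewrite /= !inordK.
have /andP[l1 h1] := truncn_itv (u0 j i).
have /andP[l2 h2] := truncn_itv (u0 k i).
rewrite -/(t j i) tjk ler_pdivlMr // in l1; rewrite -/(t j i) tjk ltr_pdivrMr // in h1.
rewrite -/(t k i) ler_pdivlMr // in l2; rewrite -/(t k i) ltr_pdivrMr // in h2.
move: h1 h2; rewrite -natr1 => h1 h2; rewrite ler_norml; lra.
Qed.

(** If every point could be improved by more than [eta], repeated improvement would exceed the
    bound. Neither a supremum nor its attainment is required. *)
Lemma near_max (R : archiRealFieldType) (U : Type) (S : U -> Prop) (phi : U -> R) (b eta : R) :
  (exists u, S u) -> (forall u, S u -> phi u <= b) -> 0 < eta ->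
  exists u, S u /\ forall v, S v -> phi v <= phi u + eta.
Proof.
move=> [u0 Su0] Sb eta0; apply: contrapT => H.
have climb n : exists u, S u /\ phi u0 + n%:R * eta <= phi u.
  elim: n => [|n [u [Su nu]]]; first by exists u0; rewrite mul0r addr0.
  apply: contrapT => H'; apply: H; exists u; split => // v Sv.
  rewrite leNgt; apply/negP => uv; apply: H'; exists v; split => //.
  by rewrite -natr1; lra.
have [u [Su]] := climb (Num.truncn ((b - phi u0) / eta)).+1.
have := truncnS_gt ((b - phi u0) / eta); rewrite ltr_pdivrMr // => h1 h2.
have := Sb u Su; lra.
Qed.

Lemma outside_unit_interval (R : realFieldType) (x y n rho : R) :
  0 < rho -> rho <= x - n -> rho <= n + 1 - x -> (y <= n) || (n + 1 <= y) ->
  rho ^+ 2 <= (y - x) ^+ 2.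
Proof.
move=> rho0 xn nx /orP[yn|ny].
  by rewrite -[leRHS]sqrrN opprB lerXn2r ?nnegrE //; lra.
by rewrite lerXn2r ?nnegrE //; lra.
Qed.

Lemma sum_mul_bound (R : realDomainType) (m : nat) (x y : 'I_m -> R) (a b : R) :
  (forall i, `|x i| <= a) -> (forall i, `|y i| <= b) ->
  `|\sum_i x i * y i| <= m%:R * (a * b).
Proof.
move=> xa yb; apply: le_trans (ler_norm_sum _ _ _) _.
apply: (@le_trans _ _ (\sum_(i < m) a * b)).
  by apply: ler_sum => i _; rewrite normrM ler_pM.
by rewrite sumr_const card_ord mulr_natl.
Qed.

(* A near-maximizer w of g + eps * sum_i (d_i x)^2 is strictly exposed in the
   direction of its gradient, so the split around the fractional d_i(w) cuts it
   off by a fixed margin; the near-maximizers of successive closures therefore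
   stay apart, although the (g, d_i) coordinates are bounded. *)
Lemma split_limit (R : archiRealFieldType) (p q m : nat)
    (C : nat -> ('I_p -> R) * ('I_q -> R) -> Prop) (d : 'I_m -> 'I_p -> int)
    (gx : 'I_p -> int) (gy : 'I_q -> int) (A B theta theta2 rho : R) :
  split_closed C -> 0 <= A -> theta < theta2 -> 0 < rho ->
  (forall z, C 0%N z -> lin gx gy z <= B) ->
  (forall z i, C 0%N z -> `|ipair (d i) z.1| <= A * (B - lin gx gy z)) ->
  (forall z, C 0%N z -> theta <= lin gx gy z ->
     exists i, forall n : int, rho <= `|ipair (d i) z.1 - n%:~R|) ->
  exists k, forall z, C k z -> lin gx gy z <= theta2.
Proof.
move=> [Cdec Ccut] A_ge0 th12 rho0 gB dB frac.
set g := lin gx gy in gB dB frac *.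
pose D i (z : ('I_p -> R) * ('I_q -> R)) := ipair (d i) z.1.
have C0 k z : C k z -> C 0%N z by elim: k => // k IH /Cdec.
have Cle j k z : (j <= k)%N -> C k z -> C j z.
  by move=> /subnK<-; elim: (k - j)%N => // n IH /Cdec.
apply: contrapT => Hno.
have Hbig k : exists z, C k z /\ theta2 < g z.
  apply: contrapT => H; apply: Hno; exists k => z Cz; rewrite leNgt.
  by apply/negP => zt; apply: H; exists z.
have thB : theta2 < B.
  by have [z [Cz zt]] := Hbig 0%N; apply: lt_le_trans zt (gB _ Cz).
pose A0 := A * (B - theta).
have A00 : 0 <= A0 by rewrite mulr_ge0 // subr_ge0; lra.
pose s := (theta2 - theta) / 2.
have s0 : 0 < s by rewrite divr_gt0 // subr_gt0.
have m0 : 0 <= m%:R :> R by rewrite ler0n.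
(* With [eps * K] at most [s / 8] and [1 / 8], the quadratic term stays below [s / 8] where
   [theta <= g], and elsewhere grows by at most an eighth of the drop of [g]. *)
pose K : R := 1 + m%:R * (A0 * A0) + m%:R * (A0 * A).
have mAA : 0 <= m%:R * (A0 * A0) by apply: mulr_ge0 => //; apply: mulr_ge0.
have mA : 0 <= m%:R * (A0 * A) by apply: mulr_ge0 => //; apply: mulr_ge0.
have K0 : 0 < K by rewrite /K; lra.
pose eps := Num.min s 1 / (8 * K).
have eps0 : 0 < eps by rewrite divr_gt0 ?mulr_gt0 // lt_min s0 ltr01.
have epsK : eps * K = Num.min s 1 / 8.
  by rewrite /eps; field; rewrite gt_eqF.
have epsKs : eps * K <= s / 8 by rewrite epsK ler_pM2r ?invr_gt0 // ge_min lexx.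
have epsK1 : eps * K <= 1 / 8 by rewrite epsK ler_pM2r ?invr_gt0 // ge_min lexx orbT.
have e1 : eps * (m%:R * (A0 * A0)) <= s / 8.
  apply: le_trans epsKs; rewrite ler_pM2l // /K; lra.
have e2 : eps * (m%:R * (A0 * A)) <= 1 / 8.
  apply: le_trans epsK1; rewrite ler_pM2l // /K; lra.
(* Being at most half of [eps * rho ^+ 2], the tolerance [eta] of the maximizer leaves another [eta]
   as the depth of the cut. *)
pose eta := Num.min (eps * rho ^+ 2) s / 2.
have er0 : 0 < eps * rho ^+ 2 by rewrite mulr_gt0 // exprn_gt0.
have eta0 : 0 < eta by rewrite divr_gt0 // lt_min er0.
have etas : eta <= s / 2 by rewrite ler_pM2r ?invr_gt0 // ge_min lexx orbT.
have etar : eta <= eps * rho ^+ 2 / 2 by rewrite ler_pM2r ?invr_gt0 // ge_min lexx.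
pose Q w v := \sum_i D i w * D i v.
have DA0 z i : C 0%N z -> theta <= g z -> `|D i z| <= A0.
  move=> Cz zt; apply: le_trans (dB z i Cz) _.
  by rewrite ler_wpM2l // lerD2l lerN2.
have QA0 z : C 0%N z -> theta <= g z -> Q z z <= m%:R * (A0 * A0).
  move=> Cz zt; apply: le_trans (ler_norm _) _.
  by apply: sum_mul_bound => i; apply: DA0.
pose phi z := g z + eps * Q z z.
have sel k : exists u, (C k u /\ theta <= g u) /\
    forall v, C k v /\ theta <= g v -> phi v <= phi u + eta.
  apply: (@near_max R _ (fun z => C k z /\ theta <= g z) phi (B + s / 8) eta) => //.
    by have [z [Cz zt]] := Hbig k; exists z; split => //; lra.
  move=> z [/C0 Cz zt]; apply: lerD; first exact: gB.
  by apply: le_trans e1; rewrite ler_pM2l // QA0.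
have [w Hw] := choice sel.
have wC k : C k (w k) by have [[]] := Hw k.
have wC0 k : C 0%N (w k) by apply: C0 (wC k).
have wt k : theta <= g (w k) by have [[]] := Hw k.
have wmax k v : C k v -> theta <= g v -> phi v <= phi (w k) + eta.
  by move=> Cv vt; have [_] := Hw k; apply.
(* Comparison with a point of value above [theta2 = theta + 2 * s]: the tolerance and the quadratic
   term cost at most [s / 2 + s / 8]. *)
have ws k : theta + s <= g (w k).
  have [z [Cz zt]] := Hbig k.
  have zth : theta <= g z by lra.
  have h1 := wmax k z Cz zth.
  have h2 : eps * Q (w k) (w k) <= s / 8.
    by apply: le_trans e1; rewrite ler_pM2l // QA0.
  have h3 : 0 <= eps * Q z z.
    apply: mulr_ge0; first exact: ltW.
    by apply: sumr_ge0 => i _; rewrite -expr2 sqr_ge0.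
  move: h1; rewrite /phi => h1.
  have : theta2 = theta + 2 * s by rewrite /s; field.
  lra.
(* The gradient of [phi] at [w k], as a linear functional; it is the left-hand side of the cut. *)
pose al k z := g z + 2 * eps * Q (w k) z.
have alE k : exists a b, forall z, al k z = rlin a b z.
  exists (fun i => (gx i)%:~R + 2 * eps * \sum_l D l (w k) * (d l i)%:~R),
    (fun j => (gy j)%:~R) => z.
  rewrite /al /rlin /g /lin addrAC; congr (_ + _).
  under [RHS]eq_bigr do rewrite mulrDl.
  rewrite big_split; congr (_ + _).
  rewrite /Q mulr_sumr /=; under [RHS]eq_bigr do rewrite mulr_sumr mulr_suml.
  rewrite exchange_big; apply: eq_bigr => l _ /=.
  rewrite mulrA [D l z]/D /ipair mulr_sumr; apply: eq_bigr => i _.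
  by rewrite !mulrA.
have intS (n : int) : (n + 1)%:~R = n%:~R + 1 :> R by rewrite intrD.
have cut k z : C k.+1 z -> al k z <= al k (w k) - eta.
  have [a [b ab]] := alE k; rewrite (ab z).
  have [i Hi] := frac _ (wC0 k) (wt k).
  apply: (Ccut k a b _ (d i) (Num.floor (D i (w k)))) => v Cv; rewrite -ab => av.
  have /andP[fl fh] := floor_itv (D i (w k)).
  rewrite intS in fh.
  have r1 : rho <= D i (w k) - (Num.floor (D i (w k)))%:~R.
    by have := Hi (Num.floor (D i (w k))); rewrite ger0_norm // subr_ge0.
  have r2 : rho <= (Num.floor (D i (w k)))%:~R + 1 - D i (w k).
    have := Hi (Num.floor (D i (w k)) + 1); rewrite intS distrC ger0_norm //.
    by rewrite subr_ge0 ltW.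
  apply: contrapT => /negP; rewrite negb_and -!leNgt -/(D i v) => Hout.
  have dist : rho ^+ 2 <= (D i v - D i (w k)) ^+ 2.
    exact: outside_unit_interval rho0 r1 r2 Hout.
  move: av; rewrite ltNge => /negP; apply.
  (* Here [al v - al w] equals [phi v - phi w] minus [eps] times the squared distance of the [D]
     coordinates, hence is at most [eta - eps * rho ^+ 2 <= - eta]. *)
  have [vt|vt] := leP theta (g v).
    have := wmax k v Cv vt.
    have : (D i v - D i (w k)) ^+ 2 <= Q v v - 2 * Q (w k) v + Q (w k) (w k).
      have -> : Q v v - 2 * Q (w k) v + Q (w k) (w k) = \sum_l (D l v - D l (w k)) ^+ 2.
        rewrite /Q mulr_sumr -sumrB -big_split; apply: eq_bigr => l _ /=; ring.
      rewrite (bigD1 i) //= lerDl sumr_ge0 // => l _; exact: sqr_ge0.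
    move=> h1 h2; have h3 : eps * rho ^+ 2 <= eps * (Q v v - 2 * Q (w k) v + Q (w k) (w k)).
      by rewrite ler_pM2l //; apply: le_trans dist h1.
    rewrite /phi /al in h2 *; lra.
  (* Below [theta], near-maximality gives nothing; instead the drop [tau >= s] of [g] outweighs the
     growth of the quadratic term. *)
  have Q1 : Q (w k) v <= m%:R * (A0 * (A0 + A * (g (w k) - g v))).
    apply: le_trans (ler_norm _) _; apply: sum_mul_bound => l; first exact: DA0.
    apply: le_trans (dB v l (C0 _ _ Cv)) _.
    have : A * theta <= A * g (w k) by rewrite ler_wpM2l.
    rewrite -/g /A0; lra.
  have Q2 : 0 <= Q (w k) (w k) by rewrite sumr_ge0 // => l _; rewrite -expr2 sqr_ge0.
  have := ws k; set tau := g (w k) - g v in Q1 => wsk.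
  have tau0 : s <= tau by rewrite /tau; lra.
  have Q1' : eps * Q (w k) v <= s / 8 + tau / 8.
    apply: (@le_trans _ _ (eps * (m%:R * (A0 * A0)) + eps * (m%:R * (A0 * A)) * tau)).
      have -> : eps * (m%:R * (A0 * A0)) + eps * (m%:R * (A0 * A)) * tau =
                eps * (m%:R * (A0 * (A0 + A * tau))) by ring.
      by rewrite ler_pM2l.
    apply: lerD => //.
    have : eps * (m%:R * (A0 * A)) * tau <= 1 / 8 * tau by rewrite ler_wpM2r //; lra.
    lra.
  have Q2' : 0 <= eps * Q (w k) (w k) by rewrite mulr_ge0 // ltW.
  have : g v = g (w k) - tau by rewrite /tau; lra.
  rewrite /al; lra.
pose u k (i : option 'I_m) := if i is Some i then D i (w k) else g (w k).
have emA : 0 <= eps * (m%:R * A0) by apply: mulr_ge0; [exact: ltW|apply: mulr_ge0].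
(* Chosen so that points with [nu]-close coordinates differ in [al] by at most [eta / 2]. *)
pose nu := eta / (2 * (1 + 2 * (eps * (m%:R * A0)))).
have den0 : 0 < 1 + 2 * (eps * (m%:R * A0)) by lra.
have nu0 : 0 < nu by rewrite divr_gt0 // mulr_gt0.
have nuE : nu + 2 * (eps * (m%:R * (A0 * nu))) = eta / 2.
  by rewrite /nu; field; rewrite gt_eqF.
have [||j [k [jk Hjk]]] := @pigeonhole_close _ _ u (`|theta| + `|B| + A0) nu => //.
  move=> k [i|] /=.
    have := DA0 _ i (wC0 k) (wt k); have := normr_ge0 theta; have := normr_ge0 B; lra.
  have := gB _ (wC0 k); have := wt k; have := ler_norm B; have := ler_norm (- theta).
  rewrite normrN ler_norml; have := normr_ge0 theta; have := normr_ge0 B; lra.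
(* Since [j < k], the point [w k] satisfies the cut made at [w j], although it is too close to [w j]
   for that. *)
have := cut j (w k) (Cle _ _ _ jk (wC k)).
have h1 := Hjk None; rewrite /= ler_norml in h1.
have h2 : Q (w j) (w j) - Q (w j) (w k) <= m%:R * (A0 * nu).
  have -> : Q (w j) (w j) - Q (w j) (w k) = \sum_i D i (w j) * (D i (w j) - D i (w k)).
    by rewrite /Q -sumrB; apply: eq_bigr => i _; rewrite mulrBr.
  apply: le_trans (ler_norm _) _; apply: sum_mul_bound => i; first exact: DA0.
  exact: Hjk (Some i).
have h3 : eps * (Q (w j) (w j) - Q (w j) (w k)) <= eps * (m%:R * (A0 * nu)) by rewrite ler_pM2l.
rewrite /al; lra.
Qed.

(** * Limits of split closures of a polyhedron given by generators *)

Definition int_vec {R : pzRingType} {p : nat} (x : 'I_p -> R) : Prop :=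
  exists n : 'I_p -> int, forall i, x i = (n i)%:~R.

Lemma int_vecE (R : pzRingType) (p : nat) (a n : 'I_p -> int) (x : 'I_p -> R) :
  (forall i, x i = (n i)%:~R) -> ipair a x = (ipair a n)%:~R.
Proof. by move=> xn; rewrite (eq_ipair _ xn) ipair_intr. Qed.

(** The coefficients [c] live on rays only, so the point moves in a recession direction. *)
Lemma gen_poly_add (R : numDomainType) (s p q : nat) (X : 'I_s -> 'I_p -> int)
    (Y : 'I_s -> 'I_q -> int) (T : 'I_s -> int) (z : ('I_p -> R) * ('I_q -> R))
    (c : 'I_s -> R) :
  gen_poly X Y T z -> (forall j, 0 <= c j) -> (forall j, T j != 0 -> c j = 0) ->
  gen_poly X Y T (fun i => z.1 i + \sum_j c j * (X j i)%:~R,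
                  fun i => z.2 i + \sum_j c j * (Y j i)%:~R).
Proof.
move=> [c' [c'0 z1 z2 c'T]] c0 cT; exists (fun j => c' j + c j); split => /=.
- by move=> j; rewrite addr_ge0.
- by move=> i; rewrite z1 -big_split; apply: eq_bigr => j _; rewrite mulrDl.
- by move=> i; rewrite z2 -big_split; apply: eq_bigr => j _; rewrite mulrDl.
- under eq_bigr do rewrite mulrDl.
  rewrite big_split /= c'T big1 ?addr0 // => j _.
  by have [->|/cT->] := eqVneq (T j) 0; rewrite ?mul0r ?mulr0.
Qed.

Lemma lin_add (R : comPzRingType) (s p q : nat) (X : 'I_s -> 'I_p -> int)
    (Y : 'I_s -> 'I_q -> int) (z : ('I_p -> R) * ('I_q -> R)) (c : 'I_s -> R)
    (gx : 'I_p -> int) (gy : 'I_q -> int) :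
  lin gx gy (fun i => z.1 i + \sum_j c j * (X j i)%:~R,
             fun i => z.2 i + \sum_j c j * (Y j i)%:~R) =
  lin gx gy z + \sum_j c j * (ipair gx (X j) + ipair gy (Y j))%:~R.
Proof.
rewrite /lin /= !ipairD !ipair_comb addrACA -big_split; congr (_ + _).
by apply: eq_bigr => j _; rewrite rmorphD mulrDr.
Qed.

(** A positive slope is an integer, hence at least 1, and a long step along the ray would exceed
    [B]. *)
Lemma ray_nonpos (R : archiRealFieldType) (s p q : nat) (X : 'I_s -> 'I_p -> int)
    (Y : 'I_s -> 'I_q -> int) (T : 'I_s -> int) (gx : 'I_p -> int) (gy : 'I_q -> int)
    (B : R) (z0 : ('I_p -> R) * ('I_q -> R)) (j : 'I_s) :
  gen_poly X Y T z0 -> (forall z, gen_poly X Y T z -> lin gx gy z <= B) ->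
  T j = 0 -> ipair gx (X j) + ipair gy (Y j) <= 0.
Proof.
move=> z0P gB Tj; set gj := _ + _; rewrite leNgt; apply/negP => gj0.
have B0 := gB _ z0P.
pose t := B - lin gx gy z0 + 1; have t0 : 0 < t by rewrite /t; lra.
have := gB _ (gen_poly_add (c := fun k => if k == j then t else 0) z0P _ _).
rewrite lin_add (bigD1 j) //= eqxx big1 ?addr0 => [|k /negPf->]; last by rewrite mul0r.
move=> H; have {H} : lin gx gy z0 + t * gj%:~R <= B.
  apply: H => [k|k]; first by case: ifP => // _; apply: ltW.
  by have [->|//] := eqVneq k j; rewrite Tj eqxx.
have : 1 <= gj%:~R :> R by rewrite -[1]/(1%:~R) ler_int.
rewrite /t in t0 *; nra.
Qed.

(** Reduces to [split_limit], with functionals [d] that detect integrality modulo the flat rays,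
    those on which the objective is constant. All other rays lower it by at least 1, which bounds
    [d] linearly in [B - g]. *)
Lemma split_gen_limit (R : archiRealFieldType) (s p q : nat) (X : 'I_s -> 'I_p -> int)
    (Y : 'I_s -> 'I_q -> int) (T : 'I_s -> int)
    (C : nat -> ('I_p -> R) * ('I_q -> R) -> Prop)
    (gx : 'I_p -> int) (gy : 'I_q -> int) (gam theta : R) :
  (forall j, 0 <= T j) -> split_closed C -> (forall z, C 0%N z <-> gen_poly X Y T z) ->
  (forall j, T j = 0 -> ipair gx (X j) + ipair gy (Y j) <= 0) ->
  (forall z, gen_poly X Y T z -> int_vec z.1 -> lin gx gy z <= gam) ->
  gam < theta ->
  exists k, forall z, C k z -> lin gx gy z <= theta.
Proof.
move=> T0 Csc C0 ray gint gth.
pose g j : int := ipair gx (X j) + ipair gy (Y j).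
pose flat j := (T j == 0) && (g j == 0).
pose N j : 'I_p -> int := if flat j then X j else fun=> 0.
have [d [u [dN span]]] := lattice_quotient R N.
pose A : int := \sum_j \sum_i `|ipair (d i) (X j)|.
pose B : int := 1 + \sum_j `|g j|.
have leA i j : `|ipair (d i) (X j)| <= A.
  rewrite /A (bigD1 j) //= (bigD1 i) //= -addrA lerDl addr_ge0 // sumr_ge0 // => k _.
  by rewrite sumr_ge0.
have leB j : 1 + g j <= B.
  rewrite lerD2l (bigD1 j) //=; apply: le_trans (ler_norm _) _.
  by rewrite lerDl sumr_ge0.
have A0 : 0 <= A by rewrite sumr_ge0 // => j _; rewrite sumr_ge0.
have B1 : 1 <= B by rewrite lerDl sumr_ge0.
(* [B] exceeds every [g j], so [B * T j - g j] is at least 1 except on flat rays, where it and [d]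
   both vanish. *)
have BT j : 0 <= B * T j - g j /\ (~~ flat j -> 1 <= B * T j - g j).
  rewrite /flat; have [Tj|Tj] := eqVneq (T j) 0.
    have := ray _ Tj; rewrite -/(g j) Tj /=; have [->|gj] := eqVneq (g j) 0; lia.
  have := T0 j; have := leB j; move: Tj; nia.
have bndz i j : `|ipair (d i) (X j)| <= A * (B * T j - g j).
  have [fj|nfj] := boolP (flat j).
    have := dN i j; rewrite /N fj => ->; rewrite normr0 mulr_ge0 //.
    by have [] := BT j.
  by have [_ /(_ nfj) h] := BT j; have := leA i j; nia.
have Bg z : gen_poly X Y T z -> exists2 c : 'I_s -> R, (forall j, 0 <= c j) &
    (forall i, z.1 i = \sum_j c j * (X j i)%:~R) /\
    B%:~R - lin gx gy z = \sum_j c j * (B * T j - g j)%:~R.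
  move=> [c [c0 z1 z2 cT]]; exists c => //; split => //.
  have -> : B%:~R = \sum_j c j * (B * T j)%:~R.
    transitivity (B%:~R * \sum_j c j * (T j)%:~R); first by rewrite cT mulr1.
    by rewrite mulr_sumr; apply: eq_bigr => j _; rewrite intrM mulrCA.
  rewrite (lin_gen gx gy z1 z2) -sumrB.
  by apply: eq_bigr => j _; rewrite intrB mulrBr.
pose th1 := (gam + theta) / 2.
have th1g : gam < th1 by rewrite /th1; lra.
have [rows [_ rowsP]] := hypograph R X Y T d gx gy.
pose ev (r : {ffun 'I_p + bool -> int}) (delta : 'I_p -> R) :=
  ipair (fun i => r (inl i)) delta + (r (inr true))%:~R + (r (inr false))%:~R * th1.
(* Row values at integral points are discrete, so a row that holds at a point close enough to an
   integral one holds there too. *)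
have [rho rho0 Hrho] : exists2 rho, 0 < rho & forall r, r \in rows ->
    forall (delta : 'I_p -> R) (n : 'I_p -> int),
    (forall i, `|delta i - (n i)%:~R| < rho) -> ev r delta <= 0 ->
    ev r (fun i => (n i)%:~R) <= 0.
  apply: common_pos => r _.
  have [k k0 kgap] := int_gap ((r (inr false))%:~R * th1).
  pose S : R := \sum_i `|(r (inl i))%:~R|.
  have S0 : 0 <= S by rewrite sumr_ge0.
  exists (k / (S + 1)); first by rewrite divr_gt0 //; lra.
  move=> e e0; rewrite ler_pdivlMr; last by lra.
  move=> ek delta n close evd; rewrite leNgt; apply/negP.
  rewrite /ev ipair_intr -intrD => /kgap; apply/negP; rewrite -ltNge.
  rewrite intrD -ipair_intr.
  have : ipair (fun i => r (inl i)) (fun i => (n i)%:~R) -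
         ipair (fun i => r (inl i)) delta <= S * e.
    rewrite -ipairB /ipair mulr_suml; apply: ler_sum => i _.
    apply: le_trans (ler_norm _) _; rewrite normrM ler_wpM2l // distrC ltW //.
  move: evd; rewrite /ev; lra.
apply: (@split_limit R p q p C d gx gy A%:~R B%:~R th1 theta rho) => //.
- by rewrite ler0z.
- by rewrite /th1; lra.
- move=> z /C0/Bg[c c0 [_ E]]; rewrite -subr_ge0 E sumr_ge0 // => j _.
  by rewrite mulr_ge0 // ler0z; have [] := BT j.
- move=> z i /C0/Bg[c c0 [z1 ->]].
  rewrite (eq_ipair _ z1) ipair_comb mulr_sumr; apply: le_trans (ler_norm_sum _ _ _) _.
  apply: ler_sum => j _; rewrite normrM ger0_norm // mulrCA ler_wpM2l //.
  by rewrite -intr_norm -intrM ler_int.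
move=> z /C0 zP zth; apply: contrapT => H.
have /fin_all_exists[n Hn] : forall i, exists n : int, `|ipair (d i) z.1 - n%:~R| < rho.
  move=> i; apply: contrapT => Hi; apply: H; exists i => n; rewrite leNgt.
  by apply/negP => hn; apply: Hi; exists n.
(* If all [d i] were nearly integral at [z], the fibre over the rounded values would also reach
   height [th1 > gam]. *)
have /rowsP[z' [z'P z'd z'th]] : forall r, r \in rows -> ev r (fun i => (n i)%:~R) <= 0.
  move=> r rR; apply: (Hrho r rR (fun i => ipair (d i) z.1)) => //.
  by apply: (rowsP (fun i => ipair (d i) z.1) th1).1 => //; exists z.
have [c xE] := span z'.1.
(* Rounding up the coefficients of the flat rays makes the point integral; it stays in the
   polyhedron and keeps its objective value. *)
pose c' j : R := if flat j then (Num.floor (c j) + 1)%:~R - c j else 0.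
have c'0 j : 0 <= c' j.
  by rewrite /c'; case: ifP => // _; rewrite subr_ge0 ltW // floorD1_gt.
have c'T j : T j != 0 -> c' j = 0.
  by rewrite /c' /flat => /negPf->.
have := gint _ (gen_poly_add z'P c'0 c'T) _.
rewrite lin_add big1 ?addr0 => [|j _]; last first.
  rewrite /c'; case: ifP => [/andP[_ /eqP gj]|_]; last by rewrite mul0r.
  by rewrite -/(g j) gj mulr0.
move=> H'; have : lin gx gy z' <= gam; last by lra.
apply: H'.
exists (fun k => \sum_i n i * u i k + \sum_j (Num.floor (c j) + 1) * N j k) => k /=.
rewrite xE rmorphD /= !rmorph_sum -addrA; congr (_ + _).
  by apply: eq_bigr => i _; rewrite z'd /= intrM.
rewrite -big_split; apply: eq_bigr => j _ /=; rewrite intrM /N /c'.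
case: (flat j); first by rewrite -mulrDl addrC subrK.
by rewrite mulr0 mul0r mulr0 addr0.
Qed.

(** * Tilting the objective *)

Definition kronecker {p : nat} (i k : 'I_p) : int := (k == i)%:Z.

Lemma ipair_kronecker (R : pzRingType) (p : nat) (x : 'I_p -> R) (i : 'I_p) :
  ipair (kronecker i) x = x i.
Proof.
rewrite /ipair (bigD1 i) //= /kronecker eqxx mul1r big1 ?addr0 // => k /negPf->.
by rewrite mul0r.
Qed.

Lemma value_hypograph (R : realFieldType) (s p q : nat) (X : 'I_s -> 'I_p -> int)
    (Y : 'I_s -> 'I_q -> int) (T : 'I_s -> int) (gx : 'I_p -> int) (gy : 'I_q -> int) :
  exists rows : seq {ffun 'I_p + bool -> int},
    (forall r, r \in rows -> 0 <= r (inr false)) /\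
    forall (x : 'I_p -> R) (phi : R),
      (exists z, [/\ gen_poly X Y T z, z.1 =1 x & phi <= lin gx gy z]) <->
      (forall r, r \in rows -> ipair (fun i => r (inl i)) x + (r (inr true))%:~R
                    + (r (inr false))%:~R * phi <= 0).
Proof.
have [rows [r0 rowsP]] := hypograph R X Y T (@kronecker p) gx gy.
exists rows; split => // x phi; rewrite -rowsP.
by split => -[z [zP zx zphi]]; exists z; split => // i; have := zx i; rewrite ipair_kronecker.
Qed.

(* The affine majorant is a row of the hypograph of x |-> max_y f that is tight at
   the integer point, hence its slope is integral up to the factor sig. *)
Lemma support_functional (R : realFieldType) (s p q : nat) (X : 'I_s -> 'I_p -> int)
    (Y : 'I_s -> 'I_q -> int) (T : 'I_s -> int) (gx : 'I_p -> int) (gy : 'I_q -> int)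
    (x : 'I_p -> R) (gam : R) :
  (exists z, [/\ gen_poly X Y T z, z.1 =1 x & gam <= lin gx gy z]) ->
  (forall z, gen_poly X Y T z -> z.1 =1 x -> lin gx gy z <= gam) ->
  exists (a : 'I_p -> int) (sig : int), 0 < sig /\ forall z, gen_poly X Y T z ->
    sig%:~R * lin gx gy z + ipair a z.1 <= sig%:~R * gam + ipair a x.
Proof.
move=> feas opt; have [rows [rows0 rowsP]] := value_hypograph R X Y T gx gy.
have feas' := (rowsP x gam).1 feas.
(* Otherwise every row involving [phi] has slack, and the optimum over this fibre could be
   raised. *)
have [r [rR [sig0 tight]]] : exists r, r \in rows /\ 0 < r (inr false) /\
    ipair (fun i => r (inl i)) x + (r (inr true))%:~R + (r (inr false))%:~R * gam = 0.
  apply: contrapT => H.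
  have [e e0 /rowsP[z [zP zx zg]]] : exists2 e, 0 < e & forall r, r \in rows ->
      ipair (fun i => r (inl i)) x + (r (inr true))%:~R + (r (inr false))%:~R * (gam + e) <= 0.
    apply: common_pos => r rR; set v := ipair _ _ + _; set sig := r (inr false).
    have vle : v + sig%:~R * gam <= 0 by apply: feas'.
    have := rows0 _ rR; rewrite -/sig le_eqVlt => /orP[/eqP sig0|sig0].
      by exists 1 => // e _ _; move: vle; rewrite -sig0 !mul0r.
    have sigR : 0 < sig%:~R :> R by rewrite ltr0z.
    have vlt : v + sig%:~R * gam < 0.
      by rewrite lt_neqAle vle andbT; apply/eqP => E; apply: H; exists r.
    exists (- (v + sig%:~R * gam) / sig%:~R); first by rewrite divr_gt0 // oppr_gt0.
    by move=> e _; rewrite ler_pdivlMr //; lra.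
  by have := opt z zP zx; lra.
exists (fun i => r (inl i)), (r (inr false)); split => // z zP.
have := (rowsP z.1 (lin gx gy z)).1 _ r rR.
move=> H; have {H} : ipair (fun i => r (inl i)) z.1 + (r (inr true))%:~R
    + (r (inr false))%:~R * lin gx gy z <= 0 by apply: H; exists z.
lra.
Qed.

(* At integer x the values of the rows of the hypograph at height gam are discrete. *)
Lemma optimality_gap (R : archiRealFieldType) (s p q : nat) (X : 'I_s -> 'I_p -> int)
    (Y : 'I_s -> 'I_q -> int) (T : 'I_s -> int) (gx : 'I_p -> int) (gy : 'I_q -> int)
    (gam : R) :
  exists2 e, 0 < e & forall z, gen_poly X Y T z -> int_vec z.1 ->
    (forall z', gen_poly X Y T z' -> z'.1 =1 z.1 -> lin gx gy z' < gam) ->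
    lin gx gy z <= gam - e.
Proof.
have [rows [rows0 rowsP]] := value_hypograph R X Y T gx gy.
pose ev (r : {ffun 'I_p + bool -> int}) (x : 'I_p -> R) (phi : R) :=
  ipair (fun i => r (inl i)) x + (r (inr true))%:~R + (r (inr false))%:~R * phi.
have [e e0 He] : exists2 e, 0 < e & forall r, r \in rows ->
    forall (n : 'I_p -> int) (x : 'I_p -> R) phi, (forall i, x i = (n i)%:~R) ->
      ev r x phi <= 0 -> 0 < ev r x gam -> phi <= gam - e.
  apply: common_pos => r rR.
  have [k k0 kgap] := int_gap ((r (inr false))%:~R * gam).
  have sig0 : 0 <= (r (inr false))%:~R :> R by rewrite ler0z rows0.
  exists (k / ((r (inr false))%:~R + 1)); first by rewrite divr_gt0 //; lra.
  move=> e e0; rewrite ler_pdivlMr; last by lra.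
  move=> ek n x phi xn; rewrite /ev (int_vecE _ xn) -intrD => h1 /kgap h2.
  set sig := (r (inr false))%:~R in sig0 ek h1 h2.
  have h3 : k <= sig * (gam - phi) by lra.
  have h4 : 0 < gam - phi by rewrite ltNge; apply/negP => h; nra.
  (* Dividing by [sig + 1] instead of [sig] gives a threshold that is defined for [sig = 0] as
     well. *)
  have h5 : (sig + 1) * e <= (sig + 1) * (gam - phi) by lra.
  by rewrite ler_pM2l in h5; lra.
exists e => // z zP [n xn] Hz.
have [r [rR rgt]] : exists r, r \in rows /\ 0 < ev r z.1 gam.
  apply: contrapT => H.
  have /rowsP[z' [z'P z'x z'g]] : forall r, r \in rows -> ev r z.1 gam <= 0.
    by move=> r rR; rewrite leNgt; apply/negP => h; apply: H; exists r.
  by have := Hz z' z'P z'x; rewrite ltNge z'g.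
apply: (He r rR n z.1) => //.
by apply: (rowsP z.1 (lin gx gy z)).1 => //; exists z.
Qed.

(** The last hypothesis is what remains of relative interiority: a segment from an optimal integral
    point to [xb] extends beyond [xb] among points of value [gam]. *)
Lemma split_finite_bound (R : archiRealFieldType) (s p q : nat) (X : 'I_s -> 'I_p -> int)
    (Y : 'I_s -> 'I_q -> int) (T : 'I_s -> int)
    (C : nat -> ('I_p -> R) * ('I_q -> R) -> Prop)
    (fx : 'I_p -> int) (fy : 'I_q -> int) (gam B : R) (xb : 'I_p -> int) :
  (forall j, 0 <= T j) -> split_closed C -> (forall z, C 0%N z <-> gen_poly X Y T z) ->
  (forall z, gen_poly X Y T z -> lin fx fy z <= B) ->
  (forall z, gen_poly X Y T z -> int_vec z.1 -> lin fx fy z <= gam) ->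
  (exists z, [/\ gen_poly X Y T z, z.1 =1 (fun i => (xb i)%:~R) & lin fx fy z = gam]) ->
  (forall z, gen_poly X Y T z -> int_vec z.1 -> lin fx fy z = gam ->
     exists2 e, 0 < e & exists2 z', gen_poly X Y T z' /\ lin fx fy z' = gam &
       forall i, z'.1 i = (xb i)%:~R - e * (z.1 i - (xb i)%:~R)) ->
  exists k, forall z, C k z -> lin fx fy z <= gam.
Proof.
move=> T0 Csc C0 fB fint [zb [zbP zbx zbf]] inner.
have [a [sig [sig0 supp]]] : exists (a : 'I_p -> int) (sig : int), 0 < sig /\
    forall z, gen_poly X Y T z -> sig%:~R * lin fx fy z + ipair a z.1 <=
      sig%:~R * gam + ipair a (fun i => (xb i)%:~R : R).
  apply: support_functional; first by exists zb; split => //; rewrite zbf.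
  by move=> z zP zx; apply: fint => //; exists xb.
pose b : int := ipair a xb.
have {}supp z : gen_poly X Y T z -> sig%:~R * lin fx fy z + ipair a z.1 <= sig%:~R * gam + b%:~R.
  by move=> /supp; rewrite ipair_intr.
have sigR : 0 < sig%:~R :> R by rewrite ltr0z.
(* The majorant gives [a x <= b] at [z] and, at the point beyond [xb], the reverse inequality. *)
have face z : gen_poly X Y T z -> int_vec z.1 -> lin fx fy z = gam -> ipair a z.1 = b%:~R.
  move=> zP zint zf; have [e e0 [z' [z'P z'f] z'x]] := inner z zP zint zf.
  have := supp z zP; have := supp z' z'P; rewrite zf z'f (eq_ipair _ z'x).
  rewrite ipairB ipairZ ipairB ipair_intr -/b; set w := ipair a z.1 => h1 h2.
  have h3 : 0 <= e * (w - b%:~R) by lra.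
  rewrite pmulr_rge0 // in h3; lra.
have [eta eta0 gap] := @optimality_gap R s p q X Y T fx fy gam.
have gapa z : gen_poly X Y T z -> int_vec z.1 -> ipair a z.1 < b%:~R ->
    lin fx fy z <= gam - eta.
  move=> zP zint zb'; apply: gap => // z' z'P z'x.
  have z'int : int_vec z'.1 by have [n nE] := zint; exists n => i; rewrite z'x.
  rewrite lt_neqAle fint // andbT; apply/eqP => /(face z' z'P z'int).
  by rewrite (eq_ipair _ z'x) => E; rewrite E ltxx in zb'.
pose f j : int := ipair fx (X j) + ipair fy (Y j).
pose ax j : int := ipair a (X j).
have fray j : T j = 0 -> f j <= 0 by apply: ray_nonpos zbP fB.
(* Adding such a ray to the optimal point over [xb] gives another optimal integral point, to which
   [face] applies. *)
have flat j : T j = 0 -> f j = 0 -> ax j = 0.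
  move=> Tj fj.
  pose c (k : 'I_s) : R := (k == j)%:R.
  have c0 k : 0 <= c k by rewrite ler0n.
  have cT k : T k != 0 -> c k = 0.
    by rewrite /c; have [->|//] := eqVneq k j; rewrite Tj eqxx.
  have sumc (F : 'I_s -> int) : \sum_k c k * (F k)%:~R = (F j)%:~R.
    rewrite (bigD1 j) //= /c eqxx mul1r big1 ?addr0 // => k /negPf->.
    by rewrite mul0r.
  have := face _ (gen_poly_add zbP c0 cT) _ _.
  rewrite lin_add sumc -/(f j) fj addr0 /= ipairD (eq_ipair _ zbx) ipair_intr -/b => H.
  have : b%:~R + ipair a (fun i => \sum_j0 c j0 * (X j0 i)%:~R) = b%:~R :> R.
    apply: H => //; exists (fun i => xb i + X j i) => i.
    by rewrite zbx sumc intrD.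
  rewrite ipair_comb sumc -/(ax j) => /eqP.
  by rewrite -subr_eq0 addrAC subrr add0r intr_eq0 => /eqP.
(* [S] bounds [b - a x] over combinations with coefficients in [0, 1], [W] bounds [a] on rays, and
   [V * eta >= S]. In [M = V + W], the part [V] lets the gap pay for the tilt at integral points,
   and [W] keeps the tilted objective nonpositive on rays. *)
pose S : int := \sum_j `|b * T j - ax j|.
pose W : int := \sum_j `|ax j|.
pose V : int := Num.floor (S%:~R / eta) + 1.
have W0 : 0 <= W by rewrite sumr_ge0.
have S0 : 0 <= S by rewrite sumr_ge0.
have V0 : 0 < V.
  by rewrite ltzD1 floor_ge0 divr_ge0 ?ler0z // ltW.
have VS : S%:~R <= V%:~R * eta.
  by rewrite -ler_pdivrMr // ltW // floorD1_gt.
pose M : int := V + W.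
pose gx k := M * fx k - a k.
pose gy k := M * fy k.
have gE (z : ('I_p -> R) * ('I_q -> R)) : lin gx gy z = M%:~R * lin fx fy z - ipair a z.1.
  rewrite /lin /ipair mulrDr !mulr_sumr addrAC -sumrB.
  congr (_ + _); apply: eq_bigr => k _; last by rewrite intrM mulrA.
  by rewrite intrB intrM mulrBl mulrA.
have gjE j : ipair gx (X j) + ipair gy (Y j) = M * f j - ax j.
  rewrite /f /ax /gx /gy /ipair mulrDr !mulr_sumr addrAC -sumrB.
  by congr (_ + _); apply: eq_bigr => k _; rewrite !intz ?mulrBl mulrA.
have gray j : T j = 0 -> ipair gx (X j) + ipair gy (Y j) <= 0.
  move=> Tj; rewrite gjE; have := fray j Tj; rewrite le_eqVlt => /orP[/eqP fj|fj].
    by rewrite fj mulr0 flat.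
  have : `|ax j| <= W by rewrite /W (bigD1 j) //= lerDl sumr_ge0.
  rewrite /M; nia.
have base z : gen_poly X Y T z -> int_vec z.1 ->
    b%:~R - ipair a z.1 <= S%:~R -> lin gx gy z <= M%:~R * gam - b%:~R.
  move=> zP zint zS; have MR : V%:~R <= M%:~R :> R by rewrite ler_int lerDl.
  have VR : 0 < V%:~R :> R by rewrite ltr0z.
  rewrite gE; have [za|za] := ltP (ipair a z.1) b%:~R.
    have := gapa z zP zint za => h1.
    have h2 : V%:~R * eta <= M%:~R * (gam - lin fx fy z).
      by apply: ler_pM => //; [exact: ltW|exact: ltW|lra].
    lra.
  have : 0 <= M%:~R * (gam - lin fx fy z).
    by rewrite mulr_ge0 ?subr_ge0 ?fint //; lra.
  lra.
(* Removing integral multiples of rays leaves an integral point with coefficients in [0, 1], covered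
   by [base]; the removed rays only lowered the tilted objective. *)
have gint z : gen_poly X Y T z -> int_vec z.1 -> lin gx gy z <= M%:~R * gam - b%:~R.
  move=> [c [c0 z1 z2 cT]] [n nE].
  pose m j : int := if T j == 0 then Num.floor (c j) else 0.
  have m0 j : 0 <= m j by rewrite /m; case: ifP => // _; rewrite floor_ge0.
  pose c' j : R := c j - (m j)%:~R.
  have c'0 j : 0 <= c' j.
    by rewrite subr_ge0 /m; case: ifP => // _; exact: floor_le.
  have c'T : \sum_j c' j * (T j)%:~R = 1.
    transitivity (\sum_j c j * (T j)%:~R); last by [].
    apply: eq_bigr => j _; rewrite /c' /m; have [->|_] := eqVneq (T j) 0.
      by rewrite !mulr0.
    by rewrite subr0.
  have c'1 j : c' j <= 1.
    rewrite /c' /m; have [_|Tj] := eqVneq (T j) 0.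
      by have := floorD1_gt (c j); rewrite intrD; lra.
    rewrite subr0 -cT (bigD1 j) //=.
    apply: (@le_trans _ _ (c j * (T j)%:~R)).
      rewrite ler_peMr // -[1]/(1%:~R) ler_int; have := T0 j; move: Tj; lia.
    by rewrite lerDl sumr_ge0 // => k _; rewrite mulr_ge0 ?ler0z.
  pose z' : ('I_p -> R) * ('I_q -> R) :=
    (fun i => \sum_j c' j * (X j i)%:~R, fun i => \sum_j c' j * (Y j i)%:~R).
  have z'P : gen_poly X Y T z' by exists c'.
  have z'int : int_vec z'.1.
    exists (fun i => n i - \sum_j m j * X j i) => i /=.
    rewrite intrB -nE z1 rmorph_sum -sumrB; apply: eq_bigr => j _ /=.
    by rewrite intrM mulrBl.
  have -> : lin gx gy z = lin gx gy z' +
      \sum_j (m j)%:~R * (ipair gx (X j) + ipair gy (Y j))%:~R.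
    rewrite (lin_gen gx gy z1 z2) (@lin_gen _ _ _ _ X Y c' gx gy z') //.
    by rewrite -big_split; apply: eq_bigr => j _ /=; rewrite -mulrDl subrK.
  rewrite -[leRHS]addr0; apply: lerD.
    apply: base => //; rewrite ipair_comb.
    have -> : b%:~R - \sum_j c' j * (ipair a (X j))%:~R = \sum_j c' j * (b * T j - ax j)%:~R.
      have -> : b%:~R = \sum_j c' j * (b * T j)%:~R.
        transitivity (b%:~R * \sum_j c' j * (T j)%:~R); first by rewrite c'T mulr1.
        by rewrite mulr_sumr; apply: eq_bigr => j _; rewrite intrM mulrCA.
      by rewrite -sumrB; apply: eq_bigr => j _; rewrite intrB mulrBr.
    rewrite rmorph_sum; apply: ler_sum => j _ /=.
    apply: le_trans (ler_norm _) _; rewrite normrM (ger0_norm (c'0 j)) -intr_norm.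
    by rewrite ler_piMl.
  apply: sumr_le0 => j _; rewrite /m; have [Tj|_] := eqVneq (T j) 0; last by rewrite mul0r.
  by rewrite mulr_ge0_le0 ?ler0z ?floor_ge0 ?lerz0 ?gray.
have lt1 : M%:~R * gam - b%:~R < M%:~R * gam - b%:~R + 1 by rewrite ltrDl.
have [k Hk] := split_gen_limit T0 Csc C0 gray gint lt1.
exists k.+1; have [Cdec Ccut] := Csc.
have C0' z : C k z -> gen_poly X Y T z.
  by move=> Cz; apply/C0; move: Cz; elim: (k) => // n IH /Cdec.
(* Where [f > gam], the majorant gives [a x < b], and the tilted bound with its margin of 1 gives
   [a x > b - 1]. *)
apply: (Ccut k (fun i => (fx i)%:~R) (fun i => (fy i)%:~R) gam a (b - 1)) => z Cz fz.
have h1 := supp z (C0' z Cz); have := Hk z Cz; rewrite gE => h2.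
rewrite -/(lin fx fy z) in fz; rewrite intrB.
have h3 : 0 < sig%:~R * (lin fx fy z - gam) by rewrite mulr_gt0 // subr_gt0.
have h4 : 0 < M%:~R * (lin fx fy z - gam).
  by rewrite mulr_gt0 ?subr_gt0 // ltr0z /M; lia.
by apply/andP; split; lra.
Qed.

(** * Transfer to the real numbers *)

Lemma foldr_sum (T : Type) (F : T -> R) (s : seq T) :
  foldr (fun i acc => Rplus (F i) acc) (IZR Z0) s = \sum_(i <- s) F i.
Proof. by elim: s => [|x s IH]; rewrite ?big_nil ?big_cons //= IH. Qed.

Lemma dotE (n : nat) (a b : vec n) : dot a b = \sum_i a i * b i.
Proof. by rewrite /dot (foldr_sum (fun i => a i * b i)) big_enum. Qed.

Lemma wsumE (n : nat) (l : seq (R * vec n)) (i : 'I_n) :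
  wsum l i = \sum_(wz <- l) wz.1 * wz.2 i.
Proof. exact: (foldr_sum (fun wz => wz.1 * wz.2 i)). Qed.

Lemma wtotalE (A : Type) (l : seq (R * A)) : wtotal l = \sum_(wz <- l) wz.1.
Proof. exact: (foldr_sum (fun wz => wz.1)). Qed.

Definition Z_of_int (n : int) : Z :=
  match n with Posz m => Z.of_nat m | Negz m => Z.opp (Z.of_nat m.+1) end.

Lemma IZR_of_int (n : int) : IZR (Z_of_int n) = n%:~R :> R.
Proof.
case: n => n; first by rewrite /= -INR_IZR_INZ INRE.
by rewrite /Z_of_int opp_IZR -INR_IZR_INZ INRE NegzE mulrNz.
Qed.

Lemma IZR_int (z : Z) : exists n : int, IZR z = n%:~R :> R.
Proof.
have [zpos|zneg] := Z_le_dec 0 z.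
  by exists (Posz (Z.to_nat z)); rewrite -{1}(Z2Nat.id z) // -INR_IZR_INZ INRE.
exists (- Posz (Z.to_nat (- z))).
by rewrite mulrNz -[in LHS](Z.opp_involutive z) opp_IZR -{1}(Z2Nat.id (- z)) ?Z.opp_nonneg_nonpos;
  [rewrite -INR_IZR_INZ INRE|lia].
Qed.

Lemma is_rat_int (r : R) : is_rat r -> exists (n d : int), 0 < d /\ d%:~R * r = n%:~R.
Proof.
move=> [a [b [b0 ->]]]; have [n an] := IZR_int a; have [d bd] := IZR_int b.
have d0 : d != 0.
  apply/eqP => d0; apply: b0; apply: eq_IZR_R0; by rewrite bd d0.
(* The sign of the denominator moves to the numerator. *)
exists (Num.sg d * n), `|d|; split; first by rewrite normr_gt0.
by rewrite an bd RdivE normrEsg !intrM -mulrA [X in _ * X]mulrCA divff ?intr_eq0 ?mulr1.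
Qed.

Lemma common_denominator (I : finType) (v : I -> R) : (forall i, is_rat (v i)) ->
  exists (d : int) (u : I -> int), 0 < d /\ forall i, d%:~R * v i = (u i)%:~R.
Proof.
move=> vrat; have /fin_all_exists2[n nP] : forall i, exists2 nd : int * int, 0 < nd.2 &
    nd.2%:~R * v i = nd.1%:~R.
  by move=> i; have [n [d [d0 dn]]] := is_rat_int (vrat i); exists (n, d).
move=> nE; exists (\prod_i (n i).2), (fun i => (\prod_(k | k != i) (n k).2) * (n i).1).
split=> [|i]; first by apply: prodr_gt0.
by rewrite (bigD1 i) //= !intrM -nE mulrA [X in X * _ = _]mulrC.
Qed.

Lemma rational_polyhedron_generators (p q : nat) (P : pt p q -> Prop) :
  rational_polyhedron P ->
  exists (s : nat) (X : 'I_s -> 'I_p -> int) (Y : 'I_s -> 'I_q -> int) (T : 'I_s -> int),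
    (forall j, 0 <= T j) /\ forall z, P z <-> gen_poly X Y T z.
Proof.
move=> [m [A [G [b [Arat [Grat [brat PE]]]]]]].
pose row i (u : ('I_p + 'I_q) + 'I_1) : R :=
  match u with inl (inl k) => A i k | inl (inr k) => G i k | inr _ => b i end.
have rowP i : exists du : int * (('I_p + 'I_q) + 'I_1 -> int), 0 < du.1 /\
    forall k, du.1%:~R * row i k = (du.2 k)%:~R.
  have [|d [u [d0 uE]]] := @common_denominator _ (row i); first by case=> [[k|k]|k] /=.
  by exists (d, u).
have [du duP] := fin_all_exists rowP.
have [s [X [Y [T [T0 HT]]]]] := polyhedron_generators R
  (fun i k => (du i).2 (inl (inl k))) (fun i k => (du i).2 (inl (inr k)))
  (fun i => (du i).2 (inr ord0)).
exists s, X, Y, T; split => // z; rewrite PE -HT.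
have rowE i : lin (fun k => (du i).2 (inl (inl k))) (fun k => (du i).2 (inl (inr k))) z =
    (du i).1%:~R * (dot (A i) z.1 + dot (G i) z.2).
  have [_ dE] := duP i; rewrite !dotE mulrDr !mulr_sumr /lin /ipair.
  by congr (_ + _); apply: eq_bigr => k _; rewrite -dE mulrA.
have posd i : 0 < (du i).1%:~R :> R by rewrite ltr0z; have [] := duP i.
split=> H i.
  rewrite rowE; have [_ <-] := duP i; rewrite /= ler_pM2l //; exact/RleP/H.
by apply/RleP; have := H i; rewrite rowE; have [_ <-] := duP i; rewrite /= ler_pM2l.
Qed.

(** * Integer hull, split closures and relative interior *)

Lemma conv_sub (p q : nat) (S : pt p q -> Prop) (z : pt p q) : S z -> conv S z.
Proof.
move=> Sz; exists [:: (1, z)]; split.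
  by constructor => //=; split => //; apply/RleP.
rewrite wtotalE big_seq1; split => //.
by split => i; rewrite wsumE big_seq1 mul1r.
Qed.

Lemma conv_le (p q : nat) (S : pt p q -> Prop) (a : vec p) (b : vec q) (g : R) :
  (forall w, S w -> dot a w.1 + dot b w.2 <= g) ->
  forall z, conv S z -> dot a z.1 + dot b z.2 <= g.
Proof.
move=> Sg z [l [lS [l1 [z1 z2]]]].
have -> : dot a z.1 + dot b z.2 = \sum_(wz <- l) wz.1 * (dot a wz.2.1 + dot b wz.2.2).
  under [RHS]eq_bigr do rewrite mulrDr.
  rewrite big_split /= !dotE; congr (_ + _).
    under [LHS]eq_bigr do rewrite z1 wsumE big_map mulr_sumr.
    rewrite exchange_big; apply: eq_bigr => wz _ /=; rewrite dotE mulr_sumr.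
    by apply: eq_bigr => i _; rewrite mulrCA.
  under [LHS]eq_bigr do rewrite z2 wsumE big_map mulr_sumr.
  rewrite exchange_big; apply: eq_bigr => wz _ /=; rewrite dotE mulr_sumr.
  by apply: eq_bigr => i _; rewrite mulrCA.
rewrite -[leRHS]mul1r -[X in _ <= X * _]/(IZR 1) -l1 wtotalE mulr_suml.
elim: lS {l1 z1 z2} => [|wz {}l [/RleP w0 Sw] _ IH]; first by rewrite !big_nil.
by rewrite !big_cons lerD // ler_wpM2l // Sg.
Qed.

Lemma int_vecP (n : nat) (x : vec n) : int_vec x <-> forall i, is_int (x i).
Proof.
split=> [[u uE] i|H]; first by exists (Z_of_int (u i)); rewrite uE IZR_of_int.
have /fin_all_exists[u uE] : forall i, exists u : int, x i = u%:~R.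
  by move=> i; have [z ->] := H i; exact: IZR_int.
by exists u.
Qed.

Lemma dot_intr (n : nat) (a : 'I_n -> int) (x : vec n) :
  dot (fun i => IZR (Z_of_int (a i))) x = ipair a x.
Proof. by rewrite dotE; apply: eq_bigr => i _; rewrite IZR_of_int. Qed.

(** An inequality already valid on the closure persists; any other one meeting the premise is a
    genuine split cut. *)
Lemma split_rank_closure_closed (p q : nat) (P : pt p q -> Prop) :
  split_closed (fun k => split_rank_closure k P).
Proof.
split=> [k z [] //|k a b g0 e n H z [Cz Hz]].
rewrite /rlin -!dotE; apply/RleP.
have [valid|nvalid] :=
  pselect (forall z, split_rank_closure k P z -> Rle (dot a z.1 + dot b z.2) g0).
  exact: valid.
apply: Hz; split=> //; exists (fun i => Z_of_int (e i)), (Z_of_int n) => v Cv /RltP gv.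
have : g0 < rlin a b v by rewrite /rlin -!dotE.
by move=> /(H v Cv)/andP[l r]; split; apply/RltP; rewrite dot_intr IZR_of_int.
Qed.

(** No integral point lies strictly inside a split, so integral points satisfy every cut, and
    convexity carries this to [P_I]. *)
Lemma P_I_sub_split_rank_closure (p q : nat) (P : pt p q -> Prop) (k : nat) (z : pt p q) :
  (forall z, P_I P z -> P z) -> P_I P z -> split_rank_closure k P z.
Proof.
move=> PIP; elim: k z => [|k IH] z zPI; first exact: PIP.
split; first exact: IH.
move=> a b g0 [_ [d [n cut]]]; apply/RleP.
apply: conv_le zPI => w [wP wint].
rewrite leNgt; apply/negP => /RltP gw.
have Cw : split_rank_closure k P w by apply: IH; apply: conv_sub.
have [/RltP lo /RltP hi] := cut w Cw gw.
have [m mE] := (int_vecP w.1).2 wint.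
have [n' nE] := IZR_int n.
have /fin_all_exists[e eE] : forall i, exists e : int, IZR (d i) = e%:~R.
  by move=> i; exact: IZR_int.
have dE : dot (fun i => IZR (d i)) w.1 = (ipair e m)%:~R.
  by rewrite -(int_vecE e mE) dotE; apply: eq_bigr => i _; rewrite eE.
have nE1 : Rplus n'%:~R (IZR 1) = (n' + 1)%:~R by rewrite intrD.
move: lo hi; rewrite dE nE nE1 !ltr_int ltzD1.
by move=> lo /(lt_le_trans lo); rewrite ltxx.
Qed.

Lemma P_I_sub (p q : nat) (P : pt p q -> Prop) (z : pt p q) :
  rational_polyhedron P -> P_I P z -> P z.
Proof.
move=> [m [A [G [b [_ [_ [_ PE]]]]]]] zPI; apply/PE => i; apply/RleP.
by apply: conv_le zPI => w [/PE H _]; apply/RleP.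
Qed.

(** The extended point is the affine combination of [x] and [y] with weights [1 + e] and [- e]. *)
Lemma relint_extend (n : nat) (S : vec n -> Prop) (x y : vec n) :
  relint S x -> S y -> exists2 e, 0 < e & S (fun i => x i - e * (y i - x i)).
Proof.
move=> [Sx [eps [/RltP eps0 H]]] Sy.
pose Q := \sum_i (y i - x i) ^+ 2.
have Q0 : 0 <= Q by rewrite sumr_ge0 // => i _; rewrite sqr_ge0.
(* Then [e ^+ 2 * Q < eps ^+ 2], because [Q < (1 + Q) ^+ 2], also for [Q = 0]. *)
pose e := eps / (1 + Q).
have e0 : 0 < e by rewrite divr_gt0 //; lra.
exists e => //; apply: H.
  exists [:: (1 + e, x); (- e, y)]; split; first by repeat constructor.
  rewrite wtotalE !big_cons big_nil; split; first by rewrite /= addr0 addrK.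
  by move=> i; rewrite wsumE !big_cons big_nil /=; ring.
apply/RltP; rewrite /Defs.dist RsqrtE.
have -> : dot (fun i => Rminus (x i - e * (y i - x i)) (x i))
              (fun i => Rminus (x i - e * (y i - x i)) (x i)) = e ^+ 2 * Q.
  by rewrite dotE mulr_sumr; apply: eq_bigr => i _; rewrite !(RminusE, RmultE); ring.
have epsE : eps = Num.sqrt (eps ^+ 2) by rewrite sqrtr_sqr ger0_norm // ltW.
rewrite [X in _ < X]epsE ltr_sqrt ?exprn_gt0 //.
have -> : eps ^+ 2 = e ^+ 2 * (1 + Q) ^+ 2.
  by rewrite -exprMn /e divfK // gt_eqF //; lra.
rewrite ltr_pM2l ?exprn_gt0 //; nra.
Qed.

(** Clearing denominators makes the objective integral, and [relint_extend] supplies the extension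
    property at [xb]. *)
Lemma split_rank_bound (p q : nat) (P : pt p q -> Prop) (c : vec p) (h : vec q) (gstar : R) :
  rational_polyhedron P -> (forall i, is_rat (c i)) -> (forall j, is_rat (h j)) ->
  (exists B, forall z, P z -> dot c z.1 + dot h z.2 <= B) ->
  (forall z, P_I P z -> dot c z.1 + dot h z.2 <= gstar) ->
  (exists x, relint (projX (fun z => P_I P z /\ dot c z.1 + dot h z.2 = gstar)) x
             /\ forall i, is_int (x i)) ->
  exists k, forall z, split_rank_closure k P z -> dot c z.1 + dot h z.2 <= gstar.
Proof.
move=> HP crat hrat [B HB] gmax [xb [xbrel /int_vecP[n nE]]].
have PIP z : P_I P z -> P z by exact: P_I_sub.
have [s [X [Y [T [T0 PE]]]]] := rational_polyhedron_generators HP.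
pose ch (u : 'I_p + 'I_q) := match u with inl i => c i | inr j => h j end.
have [|d [f [d0 fE]]] := @common_denominator _ ch; first by case.
pose fx i := f (inl i); pose fy j := f (inr j).
have dR : 0 < d%:~R :> R by rewrite ltr0z.
have linE z : lin fx fy z = d%:~R * (dot c z.1 + dot h z.2).
  rewrite !dotE mulrDr !mulr_sumr; congr (_ + _); apply: eq_bigr => i _.
    by rewrite /fx -fE mulrA.
  by rewrite /fy -fE mulrA.
have [[y [xyPI xyg]] _] := xbrel.
have [|||z zP|k Hk] := split_finite_bound (fx := fx) (fy := fy) (gam := d%:~R * gstar)
    (B := d%:~R * B) (xb := n) T0 (split_rank_closure_closed P) PE.
- by move=> z /PE zP; rewrite linE ler_pM2l //; apply: HB.
- move=> z /PE zP zint; rewrite linE ler_pM2l //; apply: gmax.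
  by apply: conv_sub; split => //; apply/int_vecP.
- exists (xb, y); split => //; first exact/PE/PIP.
  by rewrite linE xyg.
- move/PE: zP => zP zint; rewrite linE => /(mulfI (lt0r_neq0 dR)) zg.
  have [|e e0 [y' [zPI' zg']]] := relint_extend (y := z.1) xbrel.
    exists z.2; rewrite -surjective_pairing; split => //.
    by apply: conv_sub; split => //; apply/int_vecP.
  exists e => //; exists (fun i => xb i - e * (z.1 i - xb i), y') => [|i].
    by split; [exact/PE/PIP|rewrite linE zg'].
  by rewrite /= !nE.
by exists k => z /Hk; rewrite linE ler_pM2l.
Qed.

Local Close Scope ring_scope.
Open Scope R_scope.

Theorem theorem2p8 (p q : nat) (P : pt p q -> Prop) (c : vec p) (h : vec q)
  (gstar : R)
  (HP : rational_polyhedron P)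
  (HPI : exists z, P_I P z)
  (Hc : forall i, is_rat (c i)) (Hh : forall j, is_rat (h j))
  (Hbdd : exists B, forall z, P z -> dot c z.1 + dot h z.2 <= B)
  (Hgstar : (exists z, P_I P z /\ dot c z.1 + dot h z.2 = gstar) /\
            (forall z, P_I P z -> dot c z.1 + dot h z.2 <= gstar))
  (Hrelint : exists x, relint (projX (fun z => P_I P z /\ dot c z.1 + dot h z.2 = gstar)) x
                       /\ forall i, is_int (x i)) :
  exists k : nat,
    is_lub (fun r => exists z, split_rank_closure k P z /\ r = dot c z.1 + dot h z.2) gstar.
Proof.
have [[z0 [z0PI z0g]] gmax] := Hgstar.
have [|z zPI|k Hk] := split_rank_bound HP Hc Hh _ _ Hrelint.
- by have [B HB] := Hbdd; exists B => z /HB/RleP.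
- exact/RleP/gmax.
exists k; split=> [r [z [Cz ->]]|r]; first exact/RleP/Hk.
(* The value is attained: the optimal point [z0] of [P_I] survives in every closure. *)
apply; exists z0; split => //.
by apply: P_I_sub_split_rank_closure => // z; apply: P_I_sub.
Qed.
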